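(* Let $G$ be a right amenable semitopological semigroup acting on $K$ and suppose that $\Omega$ is a compact group and $\gamma:G\times K\to\Omega$ a continuous cocycle. For the Koopman representations $\mathcal S^{(N)}$ of $G$ on $C(K,\mathbb C^N)$ and the Koopman representation $\mathcal T$ of the skew product action on $C(K\times\Omega)$ the following assertions are equivalent. (1) $\mathcal T$ is mean ergodic on $C(K\times\Omega)$. (2) $(\pi\circ\gamma)\mathcal S^{(N)}$ is mean ergodic on $C(K,\mathbb C^N)$ for each $\pi\in\operatorname{Rep}(\Omega,N)$ and each $N\in\mathbb N$.
   Context: $K$ is a compact (Hausdorff) space. $C(K,\mathbb C^N)$ is the space of continuous $\mathbb C^N$-valued functions with norm $\sup_{x}\|f(x)\|_2$; $C(K\times\Omega)$ has the sup norm. Operators carry the strong operator topology, in which closures are taken. A semitopological semigroup is a semigroup with a topology making multiplication separately continuous. $G$ is right amenable if there is $m\in C_b(G)'$ with $\langle m,\mathbf 1\rangle=\|m\|=1$ and $\langle m,R_gf\rangle=\langle m,f\rangle$ for all $g\in G,f\in C_b(G)$, where $R_gf(h)=f(hg)$. $G$ acts on $K$: there is a continuous map $G\times K\to K$, $(g,x)\mapsto gx$, with $(g_1g_2)x=g_1(g_2x)$. A continuous cocycle is a continuous map $\gamma:G\times K\to\Omega$ with $\gamma(g_1g_2,x)=\gamma(g_2,x)\gamma(g_1,g_2x)$. The skew product action of $G$ on $K\times\Omega$ is $g(x,\omega)=(gx,\omega\gamma(g,x))$; its Koopman representation is $\mathcal T=\{T_g\}$, $T_gF(x,\omega)=F(gx,\omega\gamma(g,x))$.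 $\mathcal S^{(N)}=\{S_g\}$ with $S_gf(x)=f(gx)$ on $C(K,\mathbb C^N)$. $\operatorname{Rep}(\Omega,N)$ is the set of irreducible (continuous) $N$-dimensional representations $\pi$ of $\Omega$ on $\mathbb C^N$, always taken to be unitary, $\pi:\Omega\to U(N)$ (after choosing an appropriate inner product). $(\pi\circ\gamma)\mathcal S^{(N)}=\{(\pi\circ\gamma)(g,\cdot)S_g:g\in G\}$ where $(\pi\circ\gamma)(g,\cdot)S_gf(x)=\pi(\gamma(g,x))f(gx)$. A bounded operator semigroup $\mathcal R$ on a Banach space is mean ergodic if $\overline{\operatorname{co}}\,\mathcal R$ contains a zero element $P$, i.e. $PT=TP=P$ for all $T\in\overline{\operatorname{co}}\,\mathcal R$. *)

(* Defs.v *)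
From HB Require Import structures.
From mathcomp Require Import all_boot all_order all_algebra.
From mathcomp Require Import complex.
From mathcomp Require Import ring.
From mathcomp Require Import all_classical all_reals all_analysis.

Set Implicit Arguments.
Unset Strict Implicit.
Unset Printing Implicit Defensive.

Import Order.TTheory GRing.Theory Num.Theory numFieldNormedType.Exports.

Local Open Scope classical_set_scope.
Local Open Scope complex_scope.
Local Open Scope sesquilinear_scope.
Local Open Scope ring_scope.

(* The numFieldType topology is only inferred on R[i]^o; it is made available
   on R[i], so that matrices over R[i] get their topology too. *)
HB.instance Definition _ (R : rcfType) := PseudoPointedMetric.copy R[i] R[i]^o.
HB.instance Definition _ (R : rcfType) := NormedModule.copy R[i] R[i]^o.

(* C^N with the Euclidean norm: the norm that the library puts on
   'cV[R[i]]_N is the maximum norm, hence the type alias. *)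
Definition Cvec (R : realType) (N : nat) : Type := 'cV[R[i]]_N.

Section euclidean_norm.
Context (R : realType) (N : nat).

HB.instance Definition _ := GRing.Lmodule.on (Cvec R N).

Definition norm2 (v : Cvec R N) : R[i] := sqrtC (\sum_i `|v i 0| ^+ 2).

Let sumsq_ge0 (I : finType) (a : I -> R[i]) : (forall i, 0 <= a i) ->
  0 <= \sum_i a i ^+ 2.
Proof. by move=> a0; apply: sumr_ge0 => i _; rewrite exprn_ge0. Qed.

Let cauchy_schwarz (I : finType) (a b : I -> R[i]) :
  (forall i, 0 <= a i) -> (forall i, 0 <= b i) ->
  (\sum_i a i * b i) ^+ 2 <= (\sum_i a i ^+ 2) * (\sum_i b i ^+ 2).
Proof.
move=> a0 b0; rewrite -subr_ge0.
have -> : (\sum_i a i ^+ 2) * (\sum_i b i ^+ 2) - (\sum_i a i * b i) ^+ 2 =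
    2^-1 * \sum_i \sum_j (a i * b j - a j * b i) ^+ 2.
  have e1 : (\sum_i a i ^+ 2) * (\sum_i b i ^+ 2) =
      \sum_i \sum_j a i ^+ 2 * b j ^+ 2.
    by rewrite mulr_suml; apply: eq_bigr => i _; rewrite mulr_sumr.
  have e2 : (\sum_i a i ^+ 2) * (\sum_i b i ^+ 2) =
      \sum_i \sum_j a j ^+ 2 * b i ^+ 2 by rewrite e1 exchange_big.
  have e3 : (\sum_i a i * b i) ^+ 2 =
      \sum_i \sum_j (a i * b i) * (a j * b j).
    by rewrite expr2 mulr_suml; apply: eq_bigr => i _; rewrite mulr_sumr.
  have n2 : 2 != 0 :> R[i] by rewrite pnatr_eq0.
  apply: (mulfI n2); rewrite mulrA mulfV// mul1r.
  transitivity (\sum_i \sum_j a i ^+ 2 * b j ^+ 2 +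
                \sum_i \sum_j a j ^+ 2 * b i ^+ 2 -
                2 * (\sum_i \sum_j (a i * b i) * (a j * b j))).
    by rewrite -e1 -e2 -e3; ring.
  rewrite mulr_sumr -big_split -sumrB; apply: eq_bigr => i _ /=.
  rewrite mulr_sumr -big_split -sumrB; apply: eq_bigr => j _ /=.
  by ring.
apply: mulr_ge0; first by rewrite invr_ge0.
apply: sumr_ge0 => i _; apply: sumr_ge0 => j _; rewrite real_exprn_even_ge0//.
by rewrite rpredB// rpredM// ger0_real.
Qed.

Let norm2D (u v : Cvec R N) : norm2 (u + v) <= norm2 u + norm2 v.
Proof.
have ge0 (w : Cvec R N) : 0 <= \sum_i `|w i 0| ^+ 2 by exact: sumsq_ge0.
rewrite -(@ler_pXn2r _ 2) ?nnegrE ?addr_ge0 ?sqrtC_ge0//.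
rewrite sqrrD !sqrtCK.
apply: (@le_trans _ _ (\sum_i (`|u i 0| + `|v i 0|) ^+ 2)).
  apply: ler_sum => i _; rewrite mxE ler_pXn2r ?nnegrE ?addr_ge0//.
  exact: ler_normD.
under eq_bigr do rewrite sqrrD.
rewrite !big_split/= lerD2r lerD2l.
rewrite -mulr2n ler_pMn2r//.
rewrite -(@ler_pXn2r _ 2) ?nnegrE ?mulr_ge0 ?sqrtC_ge0//; last first.
  by apply: sumr_ge0 => i _; rewrite mulr_ge0.
by rewrite exprMn !sqrtCK; exact: cauchy_schwarz.
Qed.

Let norm2Z (c : R[i]) (v : Cvec R N) : norm2 (c *: v) = `|c| * norm2 v.
Proof.
rewrite /norm2; under eq_bigr do rewrite mxE normrM exprMn.
rewrite -mulr_sumr rootCMl ?exprn_ge0// sqrCK//.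
Qed.

Let norm2_eq0 (v : Cvec R N) : norm2 v = 0 -> v = 0.
Proof.
move/eqP; rewrite sqrtC_eq0 psumr_eq0 => [/allP v0|i _]; last exact: exprn_ge0.
apply/matrixP => i j; rewrite ord1 mxE; apply/eqP.
by have := v0 i (mem_index_enum i); rewrite /= sqrf_eq0 normr_eq0.
Qed.

HB.instance Definition _ := Lmodule_isNormed.Build R[i] (Cvec R N)
  norm2D norm2Z norm2_eq0.

Lemma Cvec_normE (v : Cvec R N) : `|v| = sqrtC (\sum_i `|v i 0| ^+ 2).
Proof. by []. Qed.

Lemma Cvec_coord_le (v : Cvec R N) i : `|v i 0| <= `|v|.
Proof.
rewrite Cvec_normE -(@ler_pXn2r _ 2) ?nnegrE ?sqrtC_ge0 ?sumsq_ge0// sqrtCK.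
by rewrite (bigD1 i)//= lerDl sumr_ge0// => j _; rewrite exprn_ge0.
Qed.

Lemma Cvec_norm_le (v : Cvec R N) : `|v| <= \sum_i `|v i 0|.
Proof.
rewrite Cvec_normE -(@ler_pXn2r _ 2) ?nnegrE ?sqrtC_ge0 ?sumsq_ge0 ?sumr_ge0//.
rewrite sqrtCK expr2 mulr_suml; apply: ler_sum => i _.
by rewrite expr2 ler_wpM2l// (bigD1 i)//= lerDl sumr_ge0.
Qed.

Lemma Cvec_continuousP (X : topologicalType) (f : X -> Cvec R N) :
  continuous f <-> forall i, continuous (fun x => f x i 0 : R[i]).
Proof.
split=> [fc i x|fc x]; apply/cvgrPdist_lt => e e0.
  near=> y; apply: le_lt_trans (_ : `|f x - f y| < e).
    by have := Cvec_coord_le (f x - f y) i; rewrite !mxE.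
  near: y; have /cvgrPdist_lt := fc x; exact.
have e1 : 0 < e / N.+1%:R by rewrite divr_gt0.
have : \forall y \near x, forall i, `|f x i 0 - f y i 0| < e / N.+1%:R.
  by apply: filter_forall => i; have /cvgrPdist_lt := fc i x; exact.
apply: filterS => y fxy; apply: le_lt_trans (Cvec_norm_le _) _.
apply: (@le_lt_trans _ _ (\sum_(i < N) e / N.+1%:R)).
  by apply: ler_sum => i _; rewrite !mxE; exact/ltW.
rewrite sumr_const card_ord -[ltLHS]mulr_natr -mulrA gtr_pMr//.
by rewrite mulrC ltr_pdivrMr// mul1r ltr_nat.
Unshelve. all: by end_near. Qed.

End euclidean_norm.

(* The Banach space C_b(X, V) of bounded continuous functions with the supremum
   norm. If X is compact this is C(X, V), see [compact_bounded_fun]. *)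
Section bounded_continuous_functions.
Context (R : realType) (X : topologicalType) (V : normedModType R[i]).

Lemma bounded_fun_ex (f : X -> V) :
  bounded_fun f <-> exists2 M : R[i], 0 <= M & forall x, `|f x| <= M.
Proof.
split=> [/pinfty_ex_gt0[M M0 fM]|[M M0 fM]].
  by exists M; [exact: ltW|move=> x; exact: fM].
exists M; split; first exact: ger0_real.
by move=> y My x _; exact/(le_trans (fM x))/ltW.
Qed.

Lemma compact_bounded_fun (f : X -> V) :
  compact [set: X] -> continuous f -> bounded_fun f.
Proof.
rewrite compact_near_coveringP => cX cf.
have : \forall M \near (+oo : set_system R[i]), [set: X] `<=` [set x | `|f x| <= M].
  apply: cX => x _; near=> y M => /=.
  apply: (@le_trans _ _ (`|f x| + 1)).
    rewrite -lerBlDl; apply: le_trans (lerB_dist _ _) _; rewrite distrC.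
    near: y; have /cvgrPdist_le/(_ _ ltr01) := cf x; exact.
  near: M; apply: nbhs_pinfty_ge.
  by apply: rpredD; rewrite ?normr_real ?rpred1.
by apply: filterS => M fM x _; exact: fM.
Unshelve. all: by end_near. Qed.

Definition bcont_pred : {pred X -> V} :=
  fun f => `[< continuous f /\ bounded_fun f >].

Record bcont := BCont { bcont_fun :> X -> V ; _ : bcont_pred bcont_fun }.

HB.instance Definition _ := [isSub for bcont_fun].
HB.instance Definition _ := [Choice of bcont by <:].

Lemma mk_bcont_subproof (f : X -> V) :
  continuous f -> bounded_fun f -> bcont_pred f.
Proof. by move=> cf bf; exact/asboolP. Qed.

Definition mk_bcont (f : X -> V) (cf : continuous f) (bf : bounded_fun f) :=
  BCont (mk_bcont_subproof cf bf).

Lemma bcont_continuous (f : bcont) : continuous f.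
Proof. by case: f => f /= /asboolP[]. Qed.

Lemma bcont_bounded (f : bcont) : bounded_fun f.
Proof. by case: f => f /= /asboolP[]. Qed.

Lemma bcontP (f g : bcont) : f =1 g -> f = g.
Proof. by move=> fg; apply/val_inj/funext. Qed.

Lemma bcont_submod_closed : submod_closed bcont_pred.
Proof.
split.
  apply/asboolP; split; first exact: cst_continuous.
  by apply/bounded_fun_ex; exists 0 => // x; rewrite normr0.
move=> a f g /asboolP[cf bf] /asboolP[cg bg]; apply/asboolP; split.
  by move=> x; apply: cvgD; [apply: cvgZr; exact: cf|exact: cg].
have /bounded_fun_ex[M M0 fM] := bf.
have /bounded_fun_ex[N N0 gN] := bg.
apply/bounded_fun_ex; exists (`|a| * M + N); first by rewrite addr_ge0 ?mulr_ge0.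
move=> x; apply: le_trans (ler_normD _ _) _; rewrite lerD//.
by rewrite normrZ ler_wpM2l.
Qed.

HB.instance Definition _ := GRing.isSubmodClosed.Build _ _ bcont_pred
  bcont_submod_closed.
HB.instance Definition _ := [SubChoice_isSubLmodule of bcont by <:].

Definition sup_norm (f : bcont) : R[i] :=
  (sup (range (fun x => complex.Re `|f x|)))%:C.

Lemma le_sup_norm (f : bcont) x : `|f x| <= sup_norm f.
Proof.
rewrite -[leLHS]RRe_real ?normr_real// lecR; apply: ub_le_sup; last by exists x.
have /bounded_fun_ex[M M0 fM] := bcont_bounded f.
exists (complex.Re M) => _ [y _ <-].
by rewrite -lecR !RRe_real ?normr_real// ger0_real.
Qed.

Lemma sup_norm_ge0 (f : bcont) : 0 <= sup_norm f.
Proof.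
have [[x _]|X0] := pselect (exists x : X, True).
  exact: le_trans (le_sup_norm f x).
rewrite /sup_norm; have -> : range (fun x => complex.Re `|f x|) = set0.
  by apply/seteqP; split=> y []// x _ _; case: X0; exists x.
by rewrite sup0.
Qed.

Lemma sup_norm_le (f : bcont) (M : R[i]) : 0 <= M ->
  (forall x, `|f x| <= M) -> sup_norm f <= M.
Proof.
move=> M0 fM; rewrite -[leRHS]RRe_real ?ger0_real// lecR.
have [[x _]|] := pselect (exists x : X, True); last first.
  move=> X0; have -> : range (fun x => complex.Re `|f x|) = set0.
    by apply/seteqP; split=> y []// x _ _; case: X0; exists x.
  rewrite sup0.
  by rewrite -lecR RRe_real ?ger0_real.
apply: ge_sup; first by exists (complex.Re `|f x|), x.
move=> _ [y _ <-].
by rewrite -lecR !RRe_real ?normr_real// ger0_real.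
Qed.

Let sup_normD (f g : bcont) : sup_norm (f + g) <= sup_norm f + sup_norm g.
Proof.
apply: sup_norm_le => [|x]; first by rewrite addr_ge0 ?sup_norm_ge0.
apply: le_trans (ler_normD _ _) _.
by rewrite lerD// le_sup_norm.
Qed.

Let sup_normZ_le (a : R[i]) (f : bcont) : sup_norm (a *: f) <= `|a| * sup_norm f.
Proof.
apply: sup_norm_le => [|x]; first by rewrite mulr_ge0 ?sup_norm_ge0.
by rewrite [leLHS]normrZ ler_wpM2l// le_sup_norm.
Qed.

Let sup_normZ (a : R[i]) (f : bcont) : sup_norm (a *: f) = `|a| * sup_norm f.
Proof.
apply/eqP; rewrite eq_le sup_normZ_le/=.
have [->|a0] := eqVneq a 0; first by rewrite normr0 mul0r sup_norm_ge0.
rewrite -ler_pdivlMl ?normr_gt0//.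
rewrite -[in leLHS](scale1r f) -(mulVf a0) -scalerA -normfV.
exact: sup_normZ_le.
Qed.

Let sup_norm_eq0 (f : bcont) : sup_norm f = 0 -> f = 0.
Proof.
move=> f0; apply: bcontP => x; apply/eqP; rewrite -normr_eq0 eq_le normr_ge0 andbT.
by rewrite -f0 le_sup_norm.
Qed.

HB.instance Definition _ := Lmodule_isNormed.Build R[i] bcont
  sup_normD sup_normZ sup_norm_eq0.

End bounded_continuous_functions.

(* Bounded (i.e. continuous) linear operators, with the strong operator
   topology: the one induced by pointwise convergence in norm. *)
Section bounded_operators.
Context (R : realType) (E F : normedModType R[i]).

Definition bop_pred : {pred E -> F} :=
  fun T => `[< linear T /\ continuous T >].

Record bop := Bop { bop_fun :> E -> F ; _ : bop_pred bop_fun }.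

HB.instance Definition _ := [isSub for bop_fun].
HB.instance Definition _ := [Choice of bop by <:].

Lemma mk_bop_subproof (T : E -> F) : linear T -> continuous T -> bop_pred T.
Proof. by move=> lT cT; exact/asboolP. Qed.

Definition mk_bop (T : E -> F) (lT : linear T) (cT : continuous T) :=
  Bop (mk_bop_subproof lT cT).

Lemma bop_linear (T : bop) : linear T.
Proof. by case: T => T /= /asboolP[]. Qed.

Lemma bop_continuous (T : bop) : continuous T.
Proof. by case: T => T /= /asboolP[]. Qed.

Lemma bopP (S T : bop) : S =1 T -> S = T.
Proof. by move=> ST; apply/val_inj/funext. Qed.

Lemma bop_submod_closed : submod_closed bop_pred.
Proof.
split.
  apply/asboolP; split; last exact: cst_continuous.
  by move=> a u v /=; rewrite scaler0 addr0.
move=> a S T /asboolP[lS cS] /asboolP[lT cT]; apply/asboolP; split.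
  move=> b u v; rewrite /= !fctE lS lT.
  rewrite !scalerDr !scalerA [b * a]mulrC -!addrA; congr (_ + _).
  by rewrite addrCA.
by move=> x; apply: cvgD; [apply: cvgZr; exact: cS|exact: cT].
Qed.

HB.instance Definition _ := GRing.isSubmodClosed.Build _ _ bop_pred
  bop_submod_closed.
HB.instance Definition _ := [SubChoice_isSubLmodule of bop by <:].

HB.instance Definition _ := Topological.copy bop
  (initial_topology (bop_fun : bop -> {ptws E -> F})).

Lemma bop_cvgP (A : set_system bop) (FA : Filter A) (T : bop) :
  A --> T <-> forall u, S u @[S --> A] --> T u.
Proof.
pose j : bop -> {ptws E -> F} := bop_fun.
have jA : A --> T <-> j @ A --> j T.
  split=> [AT B jTB|AT B [_ [[C oC <-] CT] CB]].
    exact/AT/(initial_continuous (f := j)).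
  by apply: (filterS CB); apply: AT; exact: open_nbhs_nbhs.
rewrite jA; exact: (@pointwise_cvgP E F (j @ A) (j T)).
Qed.

Definition op_norm (T : bop) : R :=
  sup [set complex.Re `|T u| | u in [set u : E | `|u| <= 1]].

Lemma linear_bounded_continuous_fun (T : E -> F) (M : R[i]) : linear T ->
  (forall u, `|T u| <= M * `|u|) -> continuous T.
Proof.
move=> lT TM; have [N [N0 TN]] : exists N, 0 < N /\ forall u, `|T u| <= N * `|u|.
  exists (`|M| + 1); split; first by rewrite ltr_wpDl.
  move=> u; apply: le_trans (TM u) _.
  have [->|u0] := eqVneq u 0; first by rewrite normr0 !mulr0.
  rewrite ler_wpM2r//.
  have Mr : M \is Num.real.
    rewrite ger0_real// -(pmulr_lge0 _ (_ : 0 < `|u|)) ?normr_gt0//.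
    exact: le_trans (TM u).
  by apply: (le_trans (real_ler_norm Mr)); rewrite lerDl.
move=> x; apply/cvgrPdist_lt => e e0; near=> y.
have -> : T x - T y = T (x - y).
  by rewrite addrC -(scaleN1r y) addrC -scaleN1r addrC -lT addrC scaleN1r.
apply: le_lt_trans (TN _) _; rewrite -ltr_pdivlMl//.
near: y; apply: cvgr_dist_lt => //.
by rewrite mulr_gt0// invr_gt0.
Unshelve. all: by end_near. Qed.

End bounded_operators.

Section composition.
Context (R : realType) (E F H : normedModType R[i]).
Implicit Types (S : bop F H) (T : bop E F).

Lemma bop_comp_linear S T : linear (S \o T).
Proof. by move=> a u v /=; rewrite !bop_linear. Qed.

Lemma bop_comp_continuous S T : continuous (S \o T).
Proof. by move=> x; apply: continuous_comp; exact: bop_continuous. Qed.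

Definition bop_comp S T : bop E H :=
  mk_bop (bop_comp_linear S T) (@bop_comp_continuous S T).

End composition.

(* The order of R[i] makes the coefficients in {i01 R[i]} real. *)
Definition convex_hull (R : realType) (M : lmodType R[i]) (A : set M) : set M :=
  smallest (@convex_set R[i] M) A.

Record bop_semigroup (R : realType) (E : normedModType R[i]) := BopSemigroup {
  bop_semigroup_set :> set (bop E E) ;
  bop_semigroup_comp : forall S T, bop_semigroup_set S -> bop_semigroup_set T ->
    bop_semigroup_set (bop_comp S T) ;
  bop_semigroup_bounded : exists M : R[i], forall T, bop_semigroup_set T ->
    forall u, `|T u| <= M * `|u|
}.

Definition mean_ergodic (R : realType) (E : normedModType R[i])
    (S : bop_semigroup E) :=
  exists2 P : bop E E, closure (convex_hull S) P &
    forall T, closure (convex_hull S) T -> bop_comp P T = P /\ bop_comp T P = P.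

Lemma bcont_reindex_bounded (R : realType) (X : topologicalType)
    (V : normedModType R[i]) (Y : Type) (h : Y -> X) (f : bcont X V) :
  bounded_fun (fun y => f (h y)).
Proof.
have /bounded_fun_ex[M M0 fM] := bcont_bounded f.
exists M; split; first exact: ger0_real.
by move=> N MN y _; exact/(le_trans (fM _))/ltW.
Qed.

HB.structure Definition PreTopologicalSemigroup :=
  {G of Topological G & Semigroup G}.

HB.mixin Record isSemitopological G & Topological G & Semigroup G := {
  mulg_continuousl : forall h : G, continuous (fun g : G => (g * h)%g) ;
  mulg_continuousr : forall g : G, continuous (fun h : G => (g * h)%g)
}.

#[short(type="semitopSemigroupType")]
HB.structure Definition SemitopSemigroup :=
  {G of Topological G & Semigroup G & isSemitopological G}.

HB.mixin Record isTopologicalGroup G & Topological G & Group G := {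
  mulg_continuous : continuous (fun p : G * G => (p.1 * p.2)%g) ;
  invg_continuous : continuous (fun g : G => (g^-1)%g)
}.

#[short(type="topGroupType")]
HB.structure Definition TopGroup :=
  {G of Topological G & Group G & isTopologicalGroup G}.

Section right_amenable.
Context (R : realType) (G : semitopSemigroupType).

Definition bcont_cst (c : R[i]) : bcont G R[i] :=
  mk_bcont (@cst_continuous G R[i] c) (bounded_cst c setT).

Lemma right_translate_continuous (g : G) (f : bcont G R[i]) :
  continuous (fun h => f (h * g)%g).
Proof.
move=> h; apply: (@continuous_comp _ _ _ (fun h : G => (h * g)%g) f).
  exact: mulg_continuousl.
exact: bcont_continuous.
Qed.

Lemma right_translate_bounded (g : G) (f : bcont G R[i]) :
  bounded_fun (fun h => f (h * g)%g).
Proof. exact: bcont_reindex_bounded. Qed.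

Definition right_translate (g : G) (f : bcont G R[i]) : bcont G R[i] :=
  mk_bcont (@right_translate_continuous g f) (right_translate_bounded g f).

Definition right_amenable := exists m : bop (bcont G R[i]) R[i],
  [/\ m (bcont_cst 1) = 1, op_norm m = 1 &
      forall g f, m (right_translate g f) = m f].

End right_amenable.

Record continuous_action (G : semitopSemigroupType) (X : topologicalType) :=
  ContinuousAction {
  action_fun :> G -> X -> X ;
  action_continuous : continuous (fun p : G * X => action_fun p.1 p.2) ;
  actionM : forall g1 g2 x,
    action_fun (g1 * g2)%g x = action_fun g1 (action_fun g2 x)
}.

Record continuous_cocycle (G : semitopSemigroupType) (X : topologicalType)
    (a : continuous_action G X) (Omega : topGroupType) := ContinuousCocycle {
  cocycle_fun :> G -> X -> Omega ;
  cocycle_continuous : continuous (fun p : G * X => cocycle_fun p.1 p.2) ;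
  cocycleM : forall g1 g2 x,
    cocycle_fun (g1 * g2)%g x = (cocycle_fun g2 x * cocycle_fun g1 (a g2 x))%g
}.

Lemma continuous_slice (X Y Z : topologicalType) (f : X -> Y -> Z) (x : X) :
  continuous (fun p : X * Y => f p.1 p.2) -> continuous (f x).
Proof.
move=> fc y; apply: (@continuous_comp _ _ _ (fun y => (x, y))
  (fun p : X * Y => f p.1 p.2)); last exact: fc.
by apply: cvg_pair; [exact: cvg_cst|exact: cvg_id].
Qed.

Section skew_product.
Context (G : semitopSemigroupType) (X : topologicalType)
  (Omega : topGroupType) (a : continuous_action G X)
  (gamma : continuous_cocycle a Omega).

Definition skew_fun (g : G) (p : X * Omega) : X * Omega :=
  (a g p.1, (p.2 * gamma g p.1)%g).

Lemma skew_continuous :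
  continuous (fun p : G * (X * Omega) => skew_fun p.1 p.2).
Proof.
move=> [g [x w]].
have c1 : {for (g, (x, w)),
    continuous (fun p : G * (X * Omega) => (p.1, p.2.1))}.
  apply: cvg_pair; first exact: cvg_fst.
  by apply: cvg_comp; [exact: cvg_snd|exact: cvg_fst].
apply: cvg_pair.
  apply: (@continuous_comp _ _ _ (fun p : G * (X * Omega) => (p.1, p.2.1))
    (fun q : G * X => a q.1 q.2)); [exact: c1|exact: action_continuous].
apply: (@continuous_comp _ _ _ (fun p : G * (X * Omega) =>
  (p.2.2, gamma p.1 p.2.1)) (fun q : Omega * Omega => (q.1 * q.2)%g)).
  apply: cvg_pair; first by apply: cvg_comp; [exact: cvg_snd|exact: cvg_snd].
  apply: (@continuous_comp _ _ _ (fun p : G * (X * Omega) => (p.1, p.2.1))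
    (fun q : G * X => gamma q.1 q.2)); [exact: c1|exact: cocycle_continuous].
exact: mulg_continuous.
Qed.

Lemma skewM g1 g2 p : skew_fun (g1 * g2)%g p = skew_fun g1 (skew_fun g2 p).
Proof. by case: p => x w; rewrite /skew_fun/= actionM cocycleM mulgA. Qed.

Definition skew_product : continuous_action G (X * Omega)%type :=
  ContinuousAction skew_continuous skewM.

End skew_product.

Section koopman.
Context (R : realType) (G : semitopSemigroupType) (X : topologicalType)
  (a : continuous_action G X) (V : normedModType R[i]).

Lemma koopman_fun_continuous (g : G) (f : bcont X V) :
  continuous (fun x => f (a g x)).
Proof.
move=> x; apply: (@continuous_comp _ _ _ (a g) f).
  exact/continuous_slice/action_continuous.
exact: bcont_continuous.
Qed.

Definition koopman_fun (g : G) (f : bcont X V) : bcont X V :=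
  mk_bcont (@koopman_fun_continuous g f) (bcont_reindex_bounded (a g) f).

Lemma koopman_linear g : linear (koopman_fun g).
Proof. by move=> c u v; exact: bcontP. Qed.

Lemma koopman_fun_le g f : `|koopman_fun g f| <= `|f|.
Proof.
by apply: sup_norm_le => [|x]; [exact: sup_norm_ge0|exact: le_sup_norm].
Qed.

Lemma koopman_continuous g : continuous (koopman_fun g).
Proof.
apply: (@linear_bounded_continuous_fun _ _ _ _ 1); first exact: koopman_linear.
by move=> f; rewrite mul1r koopman_fun_le.
Qed.

Definition koopman (g : G) : bop (bcont X V) (bcont X V) :=
  mk_bop (koopman_linear g) (@koopman_continuous g).

Lemma koopman_comp S T : range koopman S -> range koopman T ->
  range koopman (bop_comp S T).
Proof.
move=> [g _ <-] [h _ <-]; exists (h * g)%g => //.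
by apply: bopP => f; apply: bcontP => x /=; rewrite actionM.
Qed.

Lemma koopman_bounded : exists M : R[i], forall T, range koopman T ->
  forall f, `|T f| <= M * `|f|.
Proof. by exists 1 => _ [g _ <-] f; rewrite mul1r; exact: koopman_fun_le. Qed.

Definition koopman_semigroup : bop_semigroup (bcont X V) :=
  BopSemigroup koopman_comp koopman_bounded.

End koopman.

Record unitary_rep (R : realType) (Omega : topGroupType) (N : nat) :=
  UnitaryRep {
  rep_fun :> Omega -> 'M[R[i]]_N ;
  rep_continuous : continuous rep_fun ;
  rep_unitary : forall w, rep_fun w \is unitarymx ;
  rep1 : rep_fun 1%g = 1%:M ;
  repM : forall w1 w2, rep_fun (w1 * w2)%g = rep_fun w1 *m rep_fun w2
}.

Definition irreducible_rep (R : realType) (Omega : topGroupType) (N : nat)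
    (pi : unitary_rep R Omega N) :=
  (0 < N)%N /\ forall W : {vspace 'cV[R[i]]_N},
    (forall w v, v \in W -> pi w *m v \in W) -> W = 0%VS \/ W = fullv.

(* Multiplication by a continuous family of unitary matrices on C_b(X, C^N). *)
Section multiplication_operator.
Context (R : realType) (X : topologicalType) (N : nat) (U : X -> 'M[R[i]]_N).
Context (U_cont : continuous U) (U_unitary : forall x, U x \is unitarymx).

Lemma unitarymx_norm (A : 'M[R[i]]_N) (v : Cvec R N) : A \is unitarymx ->
  `|(A *m v : Cvec R N)| = `|v|.
Proof.
move=> /unitarymxP A1.
have A2 : A ^t* *m A = 1%:M by exact: mulmx1C.
have sq (w : Cvec R N) : \sum_i `|w i 0| ^+ 2 = ((w : 'cV__) ^t* *m w) 0 0.
  rewrite mxE; apply: eq_bigr => i _.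
  by rewrite !mxE normCK mulrC.
rewrite !Cvec_normE !sq trmx_mul map_mxM mulmxA -(mulmxA _ (A^t*)) A2.
by rewrite mulmx1.
Qed.

Lemma mulop_fun_continuous (f : bcont X (Cvec R N)) :
  continuous (fun x => U x *m f x : Cvec R N).
Proof.
apply/Cvec_continuousP => i.
have /Cvec_continuousP fc := @bcont_continuous _ _ _ f.
under eq_fun do rewrite mxE.
move=> x; apply: (cvg_big (op := +%R)) => [|j _]; first exact: add_continuous.
apply: cvgM; last exact: fc.
apply: (@continuous_comp _ _ _ U (fun A : 'M[R[i]]_N => A i j)).
  exact: U_cont.
exact: coord_continuous.
Qed.

Lemma mulop_fun_bounded (f : bcont X (Cvec R N)) :
  bounded_fun (fun x => U x *m f x : Cvec R N).
Proof.
have /bounded_fun_ex[M M0 fM] := bcont_bounded f.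
by apply/bounded_fun_ex; exists M => // x; rewrite unitarymx_norm.
Qed.

Definition mulop_fun (f : bcont X (Cvec R N)) : bcont X (Cvec R N) :=
  mk_bcont (@mulop_fun_continuous f) (mulop_fun_bounded f).

Lemma mulop_linear : linear mulop_fun.
Proof.
move=> c u v; apply: bcontP => x.
exact: (linearP (mulmx (U x)) c (u x : 'cV__) (v x : 'cV__)).
Qed.

Lemma mulop_fun_le f : `|mulop_fun f| <= `|f|.
Proof.
apply: sup_norm_le => [|x]; first exact: sup_norm_ge0.
by rewrite /= unitarymx_norm// le_sup_norm.
Qed.

Lemma mulop_continuous : continuous mulop_fun.
Proof.
apply: (@linear_bounded_continuous_fun _ _ _ _ 1); first exact: mulop_linear.
by move=> f; rewrite mul1r mulop_fun_le.
Qed.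

Definition mulop : bop (bcont X (Cvec R N)) (bcont X (Cvec R N)) :=
  mk_bop mulop_linear mulop_continuous.

End multiplication_operator.

Section twisted_koopman.
Context (R : realType) (G : semitopSemigroupType) (X : topologicalType)
  (Omega : topGroupType) (a : continuous_action G X)
  (gamma : continuous_cocycle a Omega) (N : nat) (pi : unitary_rep R Omega N).

Lemma rep_cocycle_continuous g : continuous (fun x => pi (gamma g x)).
Proof.
move=> x; apply: continuous_comp; last exact: rep_continuous.
exact/continuous_slice/cocycle_continuous.
Qed.

Lemma rep_cocycle_unitary g x : pi (gamma g x) \is unitarymx.
Proof. exact: rep_unitary. Qed.

(* f |-> (x |-> pi (gamma g x) *m f (a g x)) *)
Definition twisted_koopman (g : G) :
    bop (bcont X (Cvec R N)) (bcont X (Cvec R N)) :=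
  bop_comp (mulop (@rep_cocycle_continuous g) (rep_cocycle_unitary g))
           (koopman a (Cvec R N) g).

Lemma twisted_koopman_comp S T : range twisted_koopman S ->
  range twisted_koopman T -> range twisted_koopman (bop_comp S T).
Proof.
move=> [g _ <-] [h _ <-]; exists (h * g)%g => //.
apply: bopP => f; apply: bcontP => x /=.
by rewrite actionM cocycleM repM mulmxA.
Qed.

Lemma twisted_koopman_bounded : exists M : R[i], forall T,
  range twisted_koopman T -> forall f, `|T f| <= M * `|f|.
Proof.
exists 1 => _ [g _ <-] f; rewrite mul1r.
by apply: le_trans (mulop_fun_le _ _ _) _; exact: koopman_fun_le.
Qed.

Definition twisted_koopman_semigroup : bop_semigroup (bcont X (Cvec R N)) :=
  BopSemigroup twisted_koopman_comp twisted_koopman_bounded.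

End twisted_koopman.

(* Main.v *)
Require Import Defs.
From mathcomp Require Import all_boot all_order all_algebra.
From mathcomp Require Import complex.
From mathcomp Require Import ring lra.
From mathcomp Require Import all_classical all_reals all_analysis.

Set Implicit Arguments.
Unset Strict Implicit.
Unset Printing Implicit Defensive.

Import Order.TTheory GRing.Theory Num.Theory numFieldNormedType.Exports.

Local Open Scope classical_set_scope.
Local Open Scope complex_scope.
Local Open Scope sesquilinear_scope.
Local Open Scope ring_scope.

(** Let [coef_op pi i] send a function [f] from [K] to [C^N] to the function
    [(x, w) |-> (pi w *m f x) i 0] on [K * Omega]. Since
    [pi (w * gamma g x) = pi w *m pi (gamma g x)], it intertwines the twisted
    Koopman semigroup of [pi] with the Koopman semigroup of the skew product.
    It is a contraction, and for fixed [pi] the functions [coef_op pi i f]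
    together determine [f], with a bound on its norm.

    Mean ergodicity is treated vector by vector. A fixed vector [v] is the mean
    of [u] if, for every operator [C] in the convex hull of the semigroup, [v]
    is a limit of vectors [D (C u)] with [D] in the convex hull. For a semigroup
    of contractions means are unique, they depend linearly on the vector, and
    the vectors which have a mean form a closed subspace if the space is
    complete. The semigroup is mean ergodic as soon as all vectors have a mean
    ([has_mean_mean_ergodic]): the means of finitely many vectors are
    approximated one after the other, because a further operator of the convex
    hull fixes the means that are already approximated.

    If the semigroup of the skew product is mean ergodic, operators of its
    convex hull which approximate the projection at the [N] vectors
    [coef_op pi i f] correspond to operators of the twisted semigroup whose
    values at [f] converge to a mean of [f] ([mean_ergodic_pull]).

    Conversely, if all the twisted semigroups of irreducible representations
    are mean ergodic, all the functions [coef_op pi i f] with [pi] irreducible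
    have a mean ([mean_ergodic_push]). This extends to every unitary [pi], by
    decomposing it ([mean_coef_op]), and what remains is to show that these
    functions span a dense subspace of the continuous functions on [K * Omega].
    This is the theorem of Peter and Weyl with a parameter in [K]
    ([tensor_span_dense]).

    Its proof works with real functions throughout; a real orthogonal
    representation becomes a unitary one by extension of the scalars. The Haar
    integral of a function is the constant to which its averages over finite
    sets of translates can be made uniformly close, as in von Neumann's
    construction of the mean of an almost periodic function. If a convolution
    operator has norm 1 on L2, then the powers of its composite with its
    adjoint converge, and the limit is a convolution operator which is a
    nonzero projection of finite rank ([conv_power_limit]). Its range is
    invariant under translations, so that its kernel is a sum of matrix
    coefficients ([coef_span_projection]). Consequently a kernel minus its best
    L2 approximation by matrix coefficients has operator norm zero, up to the
    error of the approximation ([coef_span_approx]), and convolving with bump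
    functions turns this into uniform approximation. *)

(** * Continuity and compactness *)

Section continuity.
Context (R : realType) (T : topologicalType).

Lemma continuous_pair (X Y : topologicalType) (u : T -> X) (v : T -> Y) :
  continuous u -> continuous v -> continuous (fun p => (u p, v p)).
Proof. by move=> cu cv p; apply: cvg_pair; [exact: cu|exact: cv]. Qed.

Lemma continuous_compose (X Y : topologicalType) (f : X -> Y) (u : T -> X) :
  continuous f -> continuous u -> continuous (fun p => f (u p)).
Proof. by move=> cf cu p; apply: continuous_comp; [exact: cu|exact: cf]. Qed.

Lemma continuous_compose2 (X Y Z : topologicalType) (f : X -> Y -> Z)
    (u : T -> X) (v : T -> Y) :
  continuous (fun p : X * Y => f p.1 p.2) ->
  continuous u -> continuous v -> continuous (fun p => f (u p) (v p)).
Proof.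
move=> cf cu cv.
exact: (@continuous_compose _ _ (fun p : X * Y => f p.1 p.2) (fun p => (u p, v p))
  cf (continuous_pair cu cv)).
Qed.

Lemma continuous_cst (X : topologicalType) (c : X) :
  continuous (fun _ : T => c).
Proof. by move=> p; exact: cvg_cst. Qed.

Lemma continuous_idfun : continuous (fun p : T => p).
Proof. by move=> p; exact: cvg_id. Qed.

Lemma continuous_add (f g : T -> R) :
  continuous f -> continuous g -> continuous (fun p => f p + g p).
Proof. by move=> cf cg p; apply: cvgD; [exact: cf|exact: cg]. Qed.

Lemma continuous_opp (f : T -> R) : continuous f -> continuous (fun p => - f p).
Proof. by move=> cf p; apply: cvgN; exact: cf. Qed.

Lemma continuous_mul (f g : T -> R) :
  continuous f -> continuous g -> continuous (fun p => f p * g p).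
Proof. by move=> cf cg p; apply: cvgM; [exact: cf|exact: cg]. Qed.

Lemma continuous_exp (f : T -> R) n :
  continuous f -> continuous (fun p => f p ^+ n).
Proof.
move=> cf; elim: n => [|n IH].
  by under eq_fun do rewrite expr0; exact: continuous_cst.
by under eq_fun do rewrite exprS; exact: continuous_mul.
Qed.

Lemma continuous_sum (I : Type) (r : seq I) (P : pred I) (f : I -> T -> R) :
  (forall i, continuous (f i)) -> continuous (fun p => \sum_(i <- r | P i) f i p).
Proof.
by move=> cf p; apply: (cvg_big (op := +%R)) => [|i _];
  [exact: add_continuous|exact: cf].
Qed.

End continuity.

Lemma continuous_mulg (T : topologicalType) (Omega : topGroupType)
    (u v : T -> Omega) :
  continuous u -> continuous v -> continuous (fun p => (u p * v p)%g).
Proof.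
apply: (@continuous_compose2 _ _ _ _ (fun x y => x * y)%g).
exact: mulg_continuous.
Qed.

Lemma continuous_invg (T : topologicalType) (Omega : topGroupType)
    (u : T -> Omega) :
  continuous u -> continuous (fun p => (u p)^-1%g).
Proof. exact: (continuous_compose (@invg_continuous Omega)). Qed.

Lemma continuous_fst (T X Y : topologicalType) (u : T -> X * Y) :
  continuous u -> continuous (fun p => (u p).1).
Proof. by apply: continuous_compose => p; exact: cvg_fst. Qed.

Lemma continuous_snd (T X Y : topologicalType) (u : T -> X * Y) :
  continuous u -> continuous (fun p => (u p).2).
Proof. by apply: continuous_compose => p; exact: cvg_snd. Qed.

(** Continuity by recursion on the shape of the function. As [continuous f]
    itself is a universally quantified statement, the case of a family of
    functions comes after those of single functions; the last but one case undoes the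
    eta-reductions that unification performs. *)
Ltac cont :=
  cbv beta; lazymatch goal with
  | H : continuous ?f |- continuous ?f => exact: H
  | |- continuous (fun p => p) => exact: continuous_idfun
  | |- continuous (fun _ => ?c) => exact: continuous_cst
  | |- continuous (fun p => (_ * _)%g) => apply: continuous_mulg; cont
  | |- continuous (fun p => (_ ^-1)%g) => apply: continuous_invg; cont
  | |- continuous (fun p => _ + _) => apply: continuous_add; cont
  | |- continuous (fun p => - _) => apply: continuous_opp; cont
  | |- continuous (fun p => _ * _) => apply: continuous_mul; cont
  | |- continuous (fun p => _ ^+ _) => apply: continuous_exp; cont
  | |- continuous (fun p => \sum_(i <- _ | _) _) => apply: continuous_sum; cont
  | |- continuous (fun p => (_, _)) => apply: continuous_pair; cont
  | |- continuous (fun p => (_).1) => apply: continuous_fst; cont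
  | |- continuous (fun p => (_).2) => apply: continuous_snd; cont
  | H : continuous (fun p => ?f p.1 p.2) |- continuous (fun p => ?f _ _) =>
      apply: (continuous_compose2 H); cont
  | H : continuous ?f |- continuous (fun p => ?f _) =>
      apply: (continuous_compose H); cont
  | H : forall i, continuous (?f i) |- continuous (fun p => ?f _ _) =>
      apply: (continuous_compose (H _)); cont
  | H : forall i, continuous (?f i) |- continuous (?f _) => exact: H
  | |- forall _, continuous _ => move=> ?; cont
  | |- continuous (?h ?a) =>
      change (continuous (fun p => h a p)); cont
  | |- _ => by []
  end.

(** * Averages over finite sets of translates *)

(** The tube lemma for real functions. It provides the moduli of continuity on
    the group, where [Z] is the group and [z0] its unit, and the continuity of
    integrals which depend on a parameter. *)
Lemma compact_uniform_near (R : realType) (Y Z : topologicalType)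
    (H : Y -> Z -> R) (z0 : Z) (e : R) : compact [set: Y] ->
  continuous (fun p : Y * Z => H p.1 p.2) -> 0 < e ->
  \forall z \near z0, forall y, `|H y z - H y z0| <= e.
Proof.
move=> /compact_near_coveringP cY cH e0.
have : \forall z \near z0, [set: Y] `<=` (fun y => `|H y z - H y z0| <= e).
  apply: cY => y _.
  have cG : continuous (fun p : Y * Z => H p.1 p.2 - H p.1 z0) by cont.
  have /cvgrPdist_le/(_ _ e0) := cG (y, z0).
  by apply: filterS => -[y' z] /=; rewrite subrr sub0r normrN.
by apply: filterS => z Hz y; exact: Hz.
Qed.

Section averages.
Context (R : realType) (Omega : topGroupType).
Implicit Types (A B : seq Omega) (f g : Omega -> R).

Definition ravg A f (x : Omega) : R := (\sum_(a <- A) f (x * a)%g) / (size A)%:R.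

Definition lavg A f (x : Omega) : R := (\sum_(a <- A) f (a * x)%g) / (size A)%:R.

Lemma ravg_le A f c : A != [::] -> (forall x, f x <= c) ->
  forall x, ravg A f x <= c.
Proof.
move=> A0 fc x; rewrite /ravg ler_pdivrMr; last by rewrite ltr0n lt0n size_eq0.
apply: (@le_trans _ _ (\sum_(a <- A) c)); first exact: ler_sum.
by rewrite big_const_seq count_predT iter_addr_0 mulr_natr.
Qed.

Lemma ravgN A f x : ravg A (fun y => - f y) x = - ravg A f x.
Proof. by rewrite /ravg sumrN mulNr. Qed.

Lemma ravg_ge A f c : A != [::] -> (forall x, c <= f x) ->
  forall x, c <= ravg A f x.
Proof.
move=> A0 fc x; rewrite -lerN2 -ravgN; apply: ravg_le => // y.
by rewrite lerN2.
Qed.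

Lemma lavg_ravg_invg A f x :
  lavg A f x = ravg [seq a^-1%g | a <- A] (fun y => f y^-1%g) x^-1%g.
Proof.
rewrite /lavg /ravg size_map big_map; congr (_ / _).
by apply: eq_bigr => a _; rewrite invgM !invgK.
Qed.

Lemma lavg_le A f c : A != [::] -> (forall x, f x <= c) ->
  forall x, lavg A f x <= c.
Proof.
by move=> A0 fc x; rewrite lavg_ravg_invg; apply: ravg_le => //; case: A A0.
Qed.

Lemma lavg_ge A f c : A != [::] -> (forall x, c <= f x) ->
  forall x, c <= lavg A f x.
Proof.
by move=> A0 fc x; rewrite lavg_ravg_invg; apply: ravg_ge => //; case: A A0.
Qed.

Lemma ravgD A f g x : ravg A (fun y => f y + g y) x = ravg A f x + ravg A g x.
Proof. by rewrite /ravg big_split/= mulrDl. Qed.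

Lemma ravgZ A f c x : ravg A (fun y => c * f y) x = c * ravg A f x.
Proof. by rewrite /ravg -mulr_sumr mulrA. Qed.

Lemma ravg_ravg A B f x :
  ravg A (ravg B f) x = ravg [seq (a * b)%g | a <- A, b <- B] f x.
Proof.
rewrite /ravg size_allpairs big_flatten/= big_map natrM invfM mulrA mulrAC; congr (_ / _).
rewrite mulr_suml; apply: eq_bigr => a _; congr (_ / _).
by rewrite big_map; apply: eq_bigr => b _; rewrite mulgA.
Qed.

Lemma ravg_lavg A B f x : ravg A (lavg B f) x = lavg B (ravg A f) x.
Proof.
rewrite /ravg /lavg -!mulr_suml exchange_big/= -!mulrA; congr (_ * _).
  apply: eq_bigr => b _; apply: eq_bigr => a _; by rewrite mulgA.
by rewrite mulrC.
Qed.

(** By compactness of the square of the group, one finite set serves all the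
    pairs [(y, z)]. In [osc_le_ravg] these come from the two points at which an
    average is compared. *)
Lemma finite_net (U : set Omega) : compact [set: Omega] -> nbhs 1%g U ->
  exists A, forall y z, exists2 a, a \in A & U (y * a * z)%g.
Proof.
move=> cO U1.
pose F : set_system (seq Omega) :=
  [set P | exists A, forall B, {subset A <= B} -> P B].
have FF : Filter F.
  split.
  - by exists [::].
  - move=> P Q [A PA] [B QB]; exists (A ++ B) => C ABC; split.
      by apply: PA => a aA; apply: ABC; rewrite mem_cat aA.
    by apply: QB => a aB; apply: ABC; rewrite mem_cat aB orbT.
  - by move=> P Q PQ [A PA]; exists A => B /PA/PQ.
have := compact_setX cO cO; rewrite setXTT => /compact_near_coveringP cOO.
pose Q B (p : Omega * Omega) := exists2 a, a \in B & U (p.1 * a * p.2)%g.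
suff /(cOO _ F Q FF)[A HA] : forall p, [set: Omega * Omega] p ->
    \forall p' \near p & B \near F, Q B p'.
  by exists A => y z; exact: (HA A (fun _ => id) (y, z)).
move=> [y z] _ /=.
have cm : continuous (fun p : Omega * Omega => p.1 * (y^-1 * z^-1) * p.2)%g.
  by cont.
have Uyz : nbhs (y, z) [set p : Omega * Omega |
    U (p.1 * (y^-1 * z^-1) * p.2)%g].
  by apply: cm; rewrite /= mulgA mulgV mul1g mulVg.
exists ([set p | U (p.1 * (y^-1 * z^-1) * p.2)%g],
        [set B : seq Omega | (y^-1 * z^-1)%g \in B]).
  split=> //=; exists [:: (y^-1 * z^-1)%g] => B; apply; exact: mem_head.
by move=> [[y' z'] B] /= [Uy aB]; exists (y^-1 * z^-1)%g.
Qed.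

(** The oscillation is estimated for families of functions with a common modulus
    of continuity: averaging over one set of translates for all members at once
    is what makes the integral additive and allows to exchange two integrals. *)
Section oscillation.
Context (P : Type).
Implicit Types (F : P -> Omega -> R).

Definition osc_le (c : R) F := forall p x y, F p x - F p y <= c.

Definition modulus_le (U : set Omega) (e : R) F :=
  forall p w h, U h -> `|F p (h * w)%g - F p w| <= e.

Lemma modulus_le_ravg A U e F : A != [::] -> modulus_le U e F ->
  modulus_le U e (fun p => ravg A (F p)).
Proof.
move=> A0 FU p w h Uh.
have -> : ravg A (F p) (h * w)%g - ravg A (F p) w =
    ravg A (fun x => F p (h * x)%g - F p x) w.
  rewrite ravgD ravgN; congr (_ - _); rewrite /ravg; congr (_ / _).
  by apply: eq_bigr => a _; rewrite mulgA.
by rewrite ler_norml; apply/andP; split; [apply: ravg_ge|apply: ravg_le] => // x;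
  have := FU p x h Uh; rewrite ler_norml => /andP[].
Qed.

Let sum_sub_le (s t : seq Omega) (f g : Omega -> R) c : size s = size t ->
  (forall a b, f a - g b <= c) ->
  \sum_(a <- s) f a - \sum_(b <- t) g b <= (size s)%:R * c.
Proof.
move=> st fg; elim: s t st => [|a s IH] [|b t]//=.
  by rewrite !big_nil subrr mul0r.
move=> [/IH st]; rewrite !big_cons; have := fg a b.
rewrite -natr1; lra.
Qed.

(** Among the summands of the averages at [x] and at [y] there is one pair of
    translates which [A] brings within [U] of each other; all the other pairs
    differ by at most [c]. *)
Lemma osc_le_ravg A U e c F : A != [::] ->
  (forall y z, exists2 a, a \in A & U (y * a * z)%g) ->
  modulus_le U e F -> osc_le c F ->
  osc_le (((size A)%:R - 1) * c / (size A)%:R + e / (size A)%:R)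
    (fun p => ravg A (F p)).
Proof.
case: A => [//|a1 A] _ netA FU Fc p x y.
have [a aA Ua] := netA x (y * a1)^-1%g.
rewrite /ravg -mulrBl -mulrDl ler_wpM2r// ?invr_ge0//.
rewrite (big_rem _ aA)/= big_cons.
have := FU p (y * a1)%g _ Ua; rewrite mulgVK ler_norml => /andP[_ Fa].
have := @sum_sub_le (rem a (a1 :: A)) A (fun a => F p (x * a)%g)
  (fun a => F p (y * a)%g) c.
rewrite size_rem//= => /(_ erefl (fun _ _ => Fc _ _ _)).
rewrite /= -natr1 addrK; lra.
Qed.

(** Each averaging step contracts the distance from the oscillation to [e / 2]
    by the factor [1 - 1 / n], where [n] depends on the modulus of continuity
    only, and averages have the same modulus of continuity. *)
Lemma osc_le_small F c0 : compact [set: Omega] -> osc_le c0 F ->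
  (forall e, 0 < e -> exists2 U, nbhs 1%g U & modulus_le U e F) ->
  forall e, 0 < e -> exists2 A, A != [::] & osc_le e (fun p => ravg A (F p)).
Proof.
move=> cO Fc0 FU e e0.
have [U U1 FUe] := FU (e / 2) ltac:(by lra).
have [A netA] := finite_net cO U1.
have A0 : A != [::] by case: (netA 1%g 1%g); case: (A).
pose n : R := (size A)%:R.
have n0 : 0 < n by rewrite ltr0n lt0n size_eq0.
have n1 : 1 <= n by rewrite ler1n lt0n size_eq0.
pose q := (n - 1) / n.
have iter k : exists2 B, B != [::] &
    osc_le (e / 2 + q ^+ k * c0) (fun p => ravg B (F p)).
  elim: k => [|k [B B0 IH]].
    exists [:: 1%g] => // p x y; rewrite /ravg !big_seq1 !mulg1 !divr1.
    have := Fc0 p x y; rewrite expr0; lra.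
  exists [seq (a * b)%g | a <- A, b <- B].
    by rewrite -size_eq0 size_allpairs muln_eq0 !size_eq0 negb_or A0 B0.
  have := osc_le_ravg A0 netA (modulus_le_ravg B0 FUe) IH.
  move=> H p x y; rewrite -!ravg_ravg; apply: le_trans (H p x y) _.
  rewrite -/n exprS /q le_eqVlt; apply/orP; left; apply/eqP.
  by field; rewrite gt_eqF.
have q0 : 0 <= q by rewrite divr_ge0 ?subr_ge0// ltW.
have q1 : `|q| < 1.
  by rewrite ger0_norm// ltr_pdivrMr// mul1r; lra.
have [k qk] : exists k, q ^+ k * c0 <= e / 2.
  have : (fun k => q ^+ k * c0) @ \oo --> (0 : R).
    by rewrite -(mul0r c0); apply: cvgMr_tmp; exact: cvg_expr.
  move=> /cvgrPdist_le/(_ (e / 2) ltac:(by lra))[N _ /(_ N (leqnn N))].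
  rewrite sub0r normrN => /ler_normlW; by exists N.
have [B B0 HB] := iter k; exists B => // p x y.
by apply: le_trans (HB p x y) _; lra.
Qed.

End oscillation.

End averages.

(** * The Haar integral of a compact group *)

Section haar.
Context (R : realType) (Omega : topGroupType).
Hypothesis cO : compact [set: Omega].
Implicit Types (A B : seq Omega) (f g : Omega -> R).

Lemma compact_continuous_bounded (T : topologicalType) (f : T -> R) :
  compact [set: T] -> continuous f -> exists M, forall x, `|f x| <= M.
Proof.
move=> cT cf; have /compact_bounded/pinfty_ex_gt0[M _ fM] :=
  continuous_compact (continuous_subspaceT cf) cT.
by exists M => x; apply: fM; exists x.
Qed.

Lemma ravg_osc_family (P : topologicalType) (F : P -> Omega -> R) (e : R) :
  compact [set: P] -> continuous (fun p : P * Omega => F p.1 p.2) -> 0 < e ->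
  exists2 A, A != [::] & osc_le e (fun p => ravg A (F p)).
Proof.
move=> cP cF; have cPO := compact_setX cP cO; rewrite setXTT in cPO.
have [M FM] := compact_continuous_bounded cPO cF.
apply: (@osc_le_small _ _ _ _ (M + M)) => // [p x y|d d0].
  by have := FM (p, x); have := FM (p, y); rewrite !ler_norml/=; lra.
have cH : continuous (fun q : (P * Omega) * Omega => F q.1.1 (q.2 * q.1.2)%g).
  by cont.
have := @compact_uniform_near R _ _ (fun q h => F q.1 (h * q.2)%g) 1%g d cPO cH d0.
move=> FU; eexists; first exact: FU.
by move=> p w h /(_ (p, w)) /=; rewrite mul1g.
Qed.

Lemma ravg_osc f e : continuous f -> 0 < e ->
  exists2 A, A != [::] & forall x y, ravg A f x - ravg A f y <= e.
Proof.
move=> cf e0; have [|A A0 HA] :=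
  @ravg_osc_family Omega (fun _ => f) e cO _ e0; first by cont.
by exists A => // x y; exact: (HA 1%g).
Qed.

Lemma lavg_osc f e : continuous f -> 0 < e ->
  exists2 B, B != [::] & forall x y, lavg B f x - lavg B f y <= e.
Proof.
move=> cf e0; have cfV : continuous (fun x => f x^-1%g) by cont.
have [A A0 HA] := ravg_osc cfV e0.
exists [seq a^-1%g | a <- A]; first by case: (A) A0.
by move=> x y; rewrite !lavg_ravg_invg -map_comp (eq_map (@invgK _)) map_id.
Qed.

(** For continuous [f], the supremum of the lower bounds of the right averages is
    the constant which these averages approach. *)
Definition haar f : R :=
  sup [set t | exists2 A, A != [::] & forall x, t <= ravg A f x].

(** Right averages and left averages commute, hence an almost constant right
    average and an almost constant left average have almost the same value. *)
Lemma haar_ravg_close f A e : continuous f -> A != [::] ->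
  (forall x y, ravg A f x - ravg A f y <= e) ->
  forall x, `|ravg A f x - haar f| <= e.
Proof.
move=> cf A0 Ae x.
have [M fM] := compact_continuous_bounded cO cf.
set S := [set t | exists2 A, A != [::] & forall x, t <= ravg A f x].
have Sx : S (ravg A f x - e) by exists A => // y; have := Ae x y; lra.
have Sub s d : 0 < d -> S s -> s <= ravg A f x + e + (d + d).
  move=> d0 [A' A'0 sA'].
  have [B B0 Bd] := lavg_osc cf d0.
  have s1 : s <= lavg B f 1%g + d.
    apply: (@le_trans _ _ (ravg A' (lavg B f) 1%g)).
      by rewrite ravg_lavg; exact: lavg_ge.
    by apply: ravg_le => // y; have := Bd y 1%g; lra.
  have s2 : lavg B f 1%g - d <= ravg A f x + e.
    apply: (@le_trans _ _ (ravg A (lavg B f) 1%g)).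
      by apply: ravg_ge => // y; have := Bd 1%g y; lra.
    by rewrite ravg_lavg; apply: lavg_le => // y; have := Ae y x; lra.
  lra.
have ubS : has_ubound S.
  by exists (ravg A f x + e + (1 + 1)) => s; exact: Sub.
rewrite ler_norml; apply/andP; split.
  rewrite lerBrDl -lerBrDr opprK; apply: ge_sup; first by exists (ravg A f x - e).
  move=> s Ss; apply/ler_addgt0Pr => d d0.
  by have := Sub s (d / 2) ltac:(lra) Ss; lra.
by rewrite lerBlDr -lerBlDl; exact: ub_le_sup.
Qed.

Lemma haar_ge f c A : continuous f -> A != [::] -> (forall x, c <= ravg A f x) ->
  c <= haar f.
Proof.
move=> cf A0 cA; apply: ub_le_sup; last by exists A.
have [M fM] := compact_continuous_bounded cO cf.
exists M => t [B B0] /(_ 1%g) /le_trans; apply; apply: ravg_le => // x.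
exact: ler_normlW.
Qed.

Lemma haar_unique f c : continuous f ->
  (forall e, 0 < e -> exists2 A, A != [::] & forall x, `|ravg A f x - c| <= e) ->
  haar f = c.
Proof.
move=> cf fc; apply/eqP; rewrite -subr_eq0 -normr_eq0 eq_le normr_ge0 andbT.
apply/ler_addgt0Pr => e e0; rewrite add0r.
have [A A0 Ae] := fc (e / 4) ltac:(lra).
have osc x y : ravg A f x - ravg A f y <= e / 2.
  by have := Ae x; have := Ae y; rewrite !ler_norml => /andP[? ?] /andP[? ?]; lra.
have := haar_ravg_close cf A0 osc 1%g; have := Ae 1%g.
by rewrite !ler_norml => /andP[? ?] /andP[? ?]; apply/andP; split; lra.
Qed.

Lemma haar_approx_family (P : topologicalType) (F : P -> Omega -> R) (e : R) :
  compact [set: P] -> continuous (fun p : P * Omega => F p.1 p.2) -> 0 < e ->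
  exists2 A, A != [::] & forall p x, `|ravg A (F p) x - haar (F p)| <= e.
Proof.
move=> cP cF e0; have [A A0 HA] := ravg_osc_family cP cF e0; exists A => // p x.
have cFp : continuous (fun w => F p w) by cont.
exact: haar_ravg_close.
Qed.

Lemma haar_approx f e : continuous f -> 0 < e ->
  exists2 A, A != [::] & forall x, `|ravg A f x - haar f| <= e.
Proof.
move=> cf e0; have [|A A0 HA] :=
  @haar_approx_family Omega (fun _ => f) e cO _ e0; first by cont.
by exists A => // x; exact: (HA 1%g).
Qed.

(** The right averages of a left translate of [f] are left translates of the right
    averages of [f]. *)
Lemma haar_translate f (g : Omega) : continuous f ->
  haar (fun x => f (g * x)%g) = haar f.
Proof.
move=> cf; apply: haar_unique; first by cont.
move=> e e0; have [A A0 Ae] := haar_approx cf e0; exists A => // x.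
rewrite (_ : ravg _ _ _ = ravg A f (g * x)%g)// /ravg; congr (_ / _).
by apply: eq_bigr => a _; rewrite mulgA.
Qed.

Lemma haarD f g : continuous f -> continuous g ->
  haar (fun x => f x + g x) = haar f + haar g.
Proof.
move=> cf cg; apply: haar_unique; first by cont.
move=> e e0.
pose F (b : bool) := if b then f else g.
have cFb b : continuous (F b) by case: b.
have Fosc b := @ravg_osc_family _ (fun _ : Omega => F b) _ cO.
have cH b : continuous (fun q : Omega * Omega => F b (q.2 * q.1)%g) by cont.
have FU b d (d0 : 0 < d) := @compact_uniform_near R _ _
  (fun w h => F b (h * w)%g) 1%g d cO (cH b) d0.
have [M0 fM0] := compact_continuous_bounded cO cf.
have [M1 gM1] := compact_continuous_bounded cO cg.
have [A A0 HA] : exists2 A, A != [::] & osc_le (e / 2) (fun b => ravg A (F b)).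
  apply: (@osc_le_small _ _ _ _ (Num.max (M0 + M0) (M1 + M1))) => //; last by lra.
    move=> b x y; rewrite le_max; apply/orP; case: b; [left|right].
      by have := fM0 x; have := fM0 y; rewrite !ler_norml /F; lra.
    by have := gM1 x; have := gM1 y; rewrite !ler_norml /F; lra.
  move=> d d0; exists [set h | forall b w, `|F b (h * w)%g - F b (1 * w)%g| <= d].
    have := FU true d d0; have := FU false d d0; apply: filterS2 => h H0 H1.
    by case.
  by move=> b w h /(_ b w); rewrite mul1g.
exists A => // x.
have := haar_ravg_close cf A0 (HA true) x.
have := haar_ravg_close cg A0 (HA false) x.
by rewrite ravgD !ler_norml => /andP[? ?] /andP[? ?]; apply/andP; split; lra.
Qed.

Lemma haarZ c f : continuous f -> haar (fun x => c * f x) = c * haar f.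
Proof.
move=> cf; apply: haar_unique; first by cont.
move=> e e0; have d0 : 0 < e / (`|c| + 1).
  by rewrite divr_gt0// ltr_wpDl.
have [A A0 Ae] := haar_approx cf d0.
exists A => // x; rewrite ravgZ -mulrBr normrM.
apply: le_trans (ler_wpM2l (normr_ge0 _) (Ae x)) _.
rewrite mulrA ler_pdivrMr; last by rewrite ltr_wpDl.
by rewrite mulrDr mulr1 [`|c| * e]mulrC lerDl ltW.
Qed.

Lemma haar_cst c : haar (fun _ => c) = c.
Proof.
apply: haar_unique; first by cont.
move=> e e0; exists [:: 1%g] => // x.
by rewrite /ravg big_seq1 divr1 subrr normr0 ltW.
Qed.

Lemma haarN f : continuous f -> haar (fun x => - f x) = - haar f.
Proof.
move=> cf; rewrite -mulN1r -haarZ//; congr haar.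
by apply/funext => x; rewrite mulN1r.
Qed.

Lemma haarB f g : continuous f -> continuous g ->
  haar (fun x => f x - g x) = haar f - haar g.
Proof. by move=> cf cg; rewrite haarD ?haarN//; cont. Qed.

Lemma haar_ge0 f : continuous f -> (forall x, 0 <= f x) -> 0 <= haar f.
Proof.
by move=> cf f0; apply: (@haar_ge _ _ [:: 1%g]) => // x; exact: ravg_ge.
Qed.

Lemma haar_le f g : continuous f -> continuous g -> (forall x, f x <= g x) ->
  haar f <= haar g.
Proof.
move=> cf cg fg; rewrite -subr_ge0 -haarB//; apply: haar_ge0; first by cont.
by move=> x; rewrite subr_ge0.
Qed.

Lemma haar_norm_le f c : continuous f -> (forall x, `|f x| <= c) ->
  `|haar f| <= c.
Proof.
move=> cf fc; have [c1 c2] : (forall x, - c <= f x) /\ (forall x, f x <= c).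
  by split=> x; have := fc x; rewrite ler_norml => /andP[].
rewrite ler_norml; apply/andP; split.
  by rewrite -[leLHS]haar_cst; apply: haar_le => //; cont.
by rewrite -[leRHS]haar_cst; apply: haar_le => //; cont.
Qed.

Lemma haar_sum (I : Type) (r : seq I) (F : I -> Omega -> R) :
  (forall i, continuous (F i)) ->
  haar (fun x => \sum_(i <- r) F i x) = \sum_(i <- r) haar (F i).
Proof.
move=> cF; elim: r => [|i r IH].
  by rewrite big_nil; under eq_fun do rewrite big_nil; exact: haar_cst.
rewrite big_cons -IH -haarD//; last by cont.
by congr haar; apply/funext => x; rewrite big_cons.
Qed.

Lemma haar_param_continuous (P : topologicalType) (F : P -> Omega -> R) :
  continuous (fun p : P * Omega => F p.1 p.2) -> continuous (fun p => haar (F p)).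
Proof.
move=> cF p0; apply/cvgrPdist_le => e e0.
have cH : continuous (fun q : Omega * P => F q.2 q.1) by cont.
have := @compact_uniform_near R _ _ (fun w p => F p w) p0 e cO cH e0.
apply: filterS => p Hp.
rewrite -haarB; [|by cont|by cont]; apply: haar_norm_le; first by cont.
by move=> x; rewrite distrC.
Qed.

(** The inner integral is approximated, uniformly in its parameter, by one finite
    average, and the outer integral commutes with finite averages. *)
Lemma haar_fubini (F : Omega -> Omega -> R) :
  continuous (fun p : Omega * Omega => F p.1 p.2) ->
  haar (fun x => haar (fun y => F x y)) = haar (fun y => haar (fun x => F x y)).
Proof.
move=> cF; have cF' : continuous (fun q : Omega * Omega => F q.2 q.1) by cont.
have cI := haar_param_continuous cF.
have cI' := @haar_param_continuous _ (fun y x => F x y) cF'.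
apply/esym/haar_unique => // e e0.
have [A A0 Ae] := haar_approx_family cO cF e0; exists A => // y.
have cA : continuous (fun x => ravg A (F x) y) by rewrite /ravg; cont.
have -> : ravg A (fun y => haar (fun x => F x y)) y = haar (fun x => ravg A (F x) y).
  transitivity (haar (fun x => (size A)%:R^-1 * \sum_(a <- A) F x (y * a)%g)).
    by rewrite haarZ ?haar_sum /ravg 1?mulrC//; cont.
  by congr haar; apply/funext => x; rewrite /ravg mulrC.
by rewrite -haarB//; apply: haar_norm_le => //; cont.
Qed.

(** Finitely many translates of the set where [f] is large cover the group,
    so that an average of [f] is bounded below. *)
Lemma haar_gt0 f c U : continuous f -> (forall x, 0 <= f x) -> 0 < c ->
  nbhs 1%g U -> (forall x, U x -> c <= f x) -> 0 < haar f.
Proof.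
move=> cf f0 c0 U1 fU; have [A netA] := finite_net cO U1.
have A0 : A != [::] by case: (netA 1%g 1%g); case: (A).
apply: (@lt_le_trans _ _ (c / (size A)%:R)).
  by rewrite divr_gt0// ltr0n lt0n size_eq0.
apply: (haar_ge cf A0) => x; rewrite /ravg ler_wpM2r ?invr_ge0//.
have [a aA] := netA x 1%g; rewrite mulg1 => /fU fa.
by rewrite (big_rem _ aA)/= -[leLHS]addr0 lerD// sumr_ge0.
Qed.

End haar.

(** * The convolution algebra of a compact group *)

Section convolution.
Context (R : realType) (Omega : topGroupType).
Hypothesis cO : compact [set: Omega].
Implicit Types (f g h k : Omega -> R).

Definition conv f g (x : Omega) : R := haar (fun y => f y * g (y^-1 * x)%g).

Definition star f (x : Omega) : R := f x^-1%g.

Definition inner f g : R := haar (fun x => f x * g x).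

Definition sqnorm f : R := inner f f.

Lemma conv_family_continuous (P : topologicalType) (F : P -> Omega -> R) g :
  continuous (fun p : P * Omega => F p.1 p.2) -> continuous g ->
  continuous (fun p : P * Omega => conv (F p.1) g p.2).
Proof.
move=> cF cg; rewrite /conv.
apply: (@haar_param_continuous _ _ cO _
  (fun (p : P * Omega) y => F p.1 y * g (y^-1 * p.2)%g)); cont.
Qed.

Lemma conv_continuous f g : continuous f -> continuous g -> continuous (conv f g).
Proof.
move=> cf cg; have cF : continuous (fun p : Omega * Omega => f p.2) by cont.
have := @conv_family_continuous _ (fun _ => f) g cF cg => cH.
by apply: (@continuous_compose2 _ _ _ _ (fun _ : Omega => conv f g) id id); cont.
Qed.

Lemma star_continuous f : continuous f -> continuous (star f).
Proof. by move=> cf; rewrite /star; cont. Qed.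

Lemma starK f : star (star f) = f.
Proof. by apply/funext => x; rewrite /star invgK. Qed.

Lemma convDl f g h : continuous f -> continuous g -> continuous h ->
  conv (fun x => f x + g x) h = fun x => conv f h x + conv g h x.
Proof.
move=> cf cg ch; apply/funext => x; rewrite /conv -haarD//; [|by cont|by cont].
by congr haar; apply/funext => y; rewrite mulrDl.
Qed.

Lemma convDr f g h : continuous f -> continuous g -> continuous h ->
  conv h (fun x => f x + g x) = fun x => conv h f x + conv h g x.
Proof.
move=> cf cg ch; apply/funext => x; rewrite /conv -haarD//; [|by cont|by cont].
by congr haar; apply/funext => y; rewrite mulrDr.
Qed.

Lemma convZl c f h : continuous f -> continuous h ->
  conv (fun x => c * f x) h = fun x => c * conv f h x.
Proof.
move=> cf ch; apply/funext => x; rewrite /conv -haarZ//; last by cont.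
by congr haar; apply/funext => y; rewrite mulrA.
Qed.

Lemma convZr c f h : continuous f -> continuous h ->
  conv h (fun x => c * f x) = fun x => c * conv h f x.
Proof.
move=> cf ch; apply/funext => x; rewrite /conv -haarZ//; last by cont.
by congr haar; apply/funext => y; rewrite mulrCA.
Qed.

Lemma convNl f h : continuous f -> continuous h ->
  conv (fun x => - f x) h = fun x => - conv f h x.
Proof.
move=> cf ch; under eq_fun do rewrite -mulN1r.
by rewrite convZl//; apply/funext => x; rewrite mulN1r.
Qed.

Lemma convNr f h : continuous f -> continuous h ->
  conv h (fun x => - f x) = fun x => - conv h f x.
Proof.
move=> cf ch; under eq_fun do rewrite -mulN1r.
by rewrite convZr//; apply/funext => x; rewrite mulN1r.
Qed.

Lemma convBl f g h : continuous f -> continuous g -> continuous h ->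
  conv (fun x => f x - g x) h = fun x => conv f h x - conv g h x.
Proof. by move=> cf cg ch; rewrite convDl ?convNl//; cont. Qed.

Lemma convBr f g h : continuous f -> continuous g -> continuous h ->
  conv h (fun x => f x - g x) = fun x => conv h f x - conv h g x.
Proof. by move=> cf cg ch; rewrite convDr ?convNr//; cont. Qed.

Lemma convA f g h : continuous f -> continuous g -> continuous h ->
  conv (conv f g) h = conv f (conv g h).
Proof.
move=> cf cg ch; apply/funext => x; rewrite /conv.
transitivity (haar (fun y => haar (fun z => f z * g (z^-1 * y)%g * h (y^-1 * x)%g))).
  congr haar; apply/funext => y; rewrite mulrC -haarZ//; last by cont.
  by congr haar; apply/funext => z; rewrite mulrC.
rewrite haar_fubini//; last by cont.
congr haar; apply/funext => z; rewrite -haarZ//; last by cont.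
rewrite -(@haar_translate _ _ cO _ z); last by cont.
by congr haar; apply/funext => y; rewrite mulKg invgM mulgA mulrA.
Qed.

Lemma star_conv f g : continuous f -> continuous g ->
  star (conv f g) = conv (star g) (star f).
Proof.
move=> cf cg; apply/funext => x; rewrite /star /conv.
rewrite -[RHS](@haar_translate _ _ cO _ x); last by cont.
congr haar; apply/funext => y; rewrite mulrC; congr (g _ * f _).
  by rewrite invgM.
by rewrite invgM invgK mulKg.
Qed.

Lemma innerC f g : inner f g = inner g f.
Proof. by congr haar; apply/funext => x; rewrite mulrC. Qed.

Lemma innerDl f g h : continuous f -> continuous g -> continuous h ->
  inner (fun x => f x + g x) h = inner f h + inner g h.
Proof.
move=> cf cg ch; rewrite /inner -haarD//; [|by cont|by cont].
by congr haar; apply/funext => y; rewrite mulrDl.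
Qed.

Lemma innerZl c f h : continuous f -> continuous h ->
  inner (fun x => c * f x) h = c * inner f h.
Proof.
move=> cf ch; rewrite /inner -haarZ//; last by cont.
by congr haar; apply/funext => y; rewrite mulrA.
Qed.

Lemma inner_suml (n : nat) (F : nat -> Omega -> R) h :
  (forall i, continuous (F i)) -> continuous h ->
  inner (fun x => \sum_(i < n) F i x) h = \sum_(i < n) inner (F i) h.
Proof.
move=> cF ch; rewrite /inner -haar_sum//; last by cont.
by congr haar; apply/funext => x; rewrite mulr_suml.
Qed.

(** The value of a kernel at the unit is the trace of its convolution operator,
    so that this is the Hilbert-Schmidt inner product. *)
Lemma inner_conv1 f g : inner f g = conv f (star g) 1%g.
Proof. by congr haar; apply/funext => y; rewrite /star mulg1 invgK. Qed.

Lemma inner_conv_adjoint f g k : continuous f -> continuous g -> continuous k ->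
  inner (conv f k) g = inner f (conv g (star k)).
Proof.
move=> cf cg ck; have cg' := star_continuous cg; have ck' := star_continuous ck.
by rewrite !inner_conv1 star_conv// starK convA.
Qed.

Lemma sqnorm_ge0 f : continuous f -> 0 <= sqnorm f.
Proof.
move=> cf; apply: haar_ge0 => //; first by cont.
by move=> x; rewrite -expr2 sqr_ge0.
Qed.

Lemma sqnormZ c f : continuous f -> sqnorm (fun x => c * f x) = c ^+ 2 * sqnorm f.
Proof.
move=> cf; rewrite /sqnorm innerZl//; last by cont.
by rewrite innerC innerZl// mulrA.
Qed.

Lemma sqnorm_sub c f g : continuous f -> continuous g ->
  sqnorm (fun x => f x - c * g x) =
  sqnorm f - 2 * c * inner f g + c ^+ 2 * sqnorm g.
Proof.
move=> cf cg; rewrite /sqnorm /inner -!haarZ//; try cont.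
rewrite -haarB//; try cont.
rewrite -haarD//; try cont.
by congr haar; apply/funext => x; ring.
Qed.

Lemma cauchy_schwarz f g : continuous f -> continuous g ->
  inner f g ^+ 2 <= sqnorm f * sqnorm g.
Proof.
move=> cf cg.
have H t : 0 <= sqnorm f - 2 * t * inner f g + t ^+ 2 * sqnorm g.
  by rewrite -sqnorm_sub//; apply: sqnorm_ge0; cont.
have := sqnorm_ge0 cg; rewrite le_eqVlt => /orP[/eqP g0|g0].
  have := sqnorm_ge0 cf; rewrite -g0 mulr0 => f0.
  have [->|b0] := eqVneq (inner f g) 0; first by rewrite expr0n.
  have := H ((sqnorm f + 1) / inner f g).
  rewrite -g0 mulr0 addr0 -mulrA divfK//; lra.
have := H (inner f g / sqnorm g).
have -> : sqnorm f - 2 * (inner f g / sqnorm g) * inner f g +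
    (inner f g / sqnorm g) ^+ 2 * sqnorm g =
    (sqnorm f * sqnorm g - inner f g ^+ 2) / sqnorm g.
  by field; rewrite gt_eqF.
by rewrite pmulr_lge0 ?invr_gt0// subr_ge0.
Qed.

(** Convolution maps L2 to bounded functions; this is what turns L2 estimates into
    uniform ones. *)
Lemma conv_sup_le f g x : continuous f -> continuous g ->
  conv f g x ^+ 2 <= sqnorm f * sqnorm (star g).
Proof.
move=> cf cg; have cgx : continuous (fun y => g (y^-1 * x)%g) by cont.
apply: le_trans (cauchy_schwarz cf cgx) _.
rewrite ler_wpM2l ?sqnorm_ge0// le_eqVlt; apply/orP; left; apply/eqP.
rewrite /sqnorm /inner -(@haar_translate _ _ cO _ x); last by cont.
by congr haar; apply/funext => y; rewrite /star invgM mulgVK.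
Qed.

Lemma sqnorm_le f c : continuous f -> (forall x, f x ^+ 2 <= c) -> sqnorm f <= c.
Proof.
move=> cf fc; rewrite -[leRHS](haar_cst cO); apply: haar_le => //; cont.
Qed.

Lemma sqnorm_conv_le f g : continuous f -> continuous g ->
  sqnorm (conv f g) <= sqnorm f * sqnorm (star g).
Proof.
move=> cf cg; apply: sqnorm_le; first exact: conv_continuous.
by move=> x; exact: conv_sup_le.
Qed.

End convolution.

(** * Projections in the convolution algebra *)

Section uniform_limits.
Context (R : realType) (T : Type).
Implicit Types (u : nat -> T -> R).

Definition uniform_lim u (q : T -> R) := forall e, 0 < e ->
  exists N, forall n, (N <= n)%N -> forall x, `|u n x - q x| <= e.

Lemma uniform_lim_unique u q q' : uniform_lim u q -> uniform_lim u q' -> q = q'.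
Proof.
move=> uq uq'; apply/funext => x; apply/eqP.
rewrite -subr_eq0 -normr_eq0 eq_le normr_ge0 andbT.
apply/ler_addgt0Pr => e e0; rewrite add0r.
have [N uN] := uq (e / 2) ltac:(lra); have [M uM] := uq' (e / 2) ltac:(lra).
have := uN (maxn N M) (leq_maxl _ _) x; have := uM (maxn N M) (leq_maxr _ _) x.
by rewrite !ler_norml; lra.
Qed.

Lemma uniform_lim_shift u q m :
  uniform_lim u q -> uniform_lim (fun n => u (n + m)%N) q.
Proof.
move=> uq e e0; have [N uN] := uq e e0; exists N => n Nn; apply: uN.
exact: leq_trans (leq_addr _ _).
Qed.

Lemma uniform_lim_ge u q x c : uniform_lim u q ->
  (forall n, c <= u n x) -> c <= q x.
Proof.
move=> uq cu; apply/ler_addgt0Pr => e e0; have [N uN] := uq e e0.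
have := uN N (leqnn N) x; have := cu N; rewrite ler_norml; lra.
Qed.

End uniform_limits.

Lemma uniform_lim_continuous (R : realType) (T : topologicalType)
    (u : nat -> T -> R) (q : T -> R) :
  (forall n, continuous (u n)) -> uniform_lim u q -> continuous q.
Proof.
move=> cu uq x; apply/cvgrPdist_le => e e0.
have [N uN] := uq (e / 4) ltac:(lra).
have /cvgrPdist_le/(_ (e / 4) ltac:(lra)) := cu N x.
apply: filterS => y uxy; have := uN N (leqnn N) x; have := uN N (leqnn N) y.
by move: uxy; rewrite !ler_norml; lra.
Qed.

Lemma uniform_cauchy_lim (R : realType) (T : Type) (u : nat -> T -> R) :
  (forall e, 0 < e -> exists N, forall n m, (N <= n)%N -> (N <= m)%N ->
    forall x, `|u n x - u m x| <= e) ->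
  exists q, uniform_lim u q.
Proof.
move=> cu.
have cvgu x : cvgn (fun n => u n x).
  apply/cauchy_cvgP/cauchy_exP => e e0.
  have [N uN] := cu (e / 2) ltac:(lra); exists (u N x).
  exists N => // n /= Nn; rewrite /ball/=.
  by apply: le_lt_trans (uN _ _ (leqnn N) Nn x) _; lra.
exists (fun x => limn (fun n => u n x)) => e e0.
have [N uN] := cu e e0; exists N => n Nn x.
rewrite distrC.
have cd : (fun m => `|u m x - u n x|) @ \oo --> `|limn (fun m => u m x) - u n x|.
  by apply: cvg_norm; apply: cvgB; [exact: cvgu|exact: cvg_cst].
rewrite -(cvg_lim _ cd)//; apply: limr_le; first by apply: cvgP cd.
by exists N => // m /= Nm; apply: uN.
Qed.

Section projection.
Context (R : realType) (Omega : topGroupType).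
Hypothesis cO : compact [set: Omega].
Implicit Types (f g h k : Omega -> R).

(** A bound on the square of the L2 operator norm of [f |-> conv f k]. *)
Definition sqopnorm_le (c : R) k :=
  forall f, continuous f -> sqnorm (conv f k) <= c * sqnorm f.

Lemma uniform_lim_convl (u : nat -> Omega -> R) q g :
  (forall n, continuous (u n)) -> continuous g -> uniform_lim u q ->
  uniform_lim (fun n => conv (u n) g) (conv q g).
Proof.
move=> cu cg uq e e0; have cq := uniform_lim_continuous cu uq.
have [M gM] := compact_continuous_bounded cO cg.
have M0 : 0 <= M by exact: le_trans (gM 1%g).
have [N uN] := uq (e / (M + 1)) ltac:(by rewrite divr_gt0//; lra).
exists N => n Nn x; rewrite /conv -haarB//; [|by cont|by cont].
apply: haar_norm_le => //; first by cont.
move=> y; rewrite -mulrBl normrM.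
apply: le_trans (ler_pM (normr_ge0 _) (normr_ge0 _) (uN n Nn y) (gM _)) _.
rewrite mulrAC ler_pdivrMr; last by lra.
by rewrite ler_wpM2l//; lra.
Qed.

Lemma sqopnorm_le_star k : continuous k -> sqopnorm_le 1 k -> sqopnorm_le 1 (star k).
Proof.
move=> ck k1 f cf; rewrite mul1r; have cks := star_continuous ck.
have cfk := conv_continuous cO cf cks; have cfkk := conv_continuous cO cfk ck.
have : sqnorm (conv f (star k)) ^+ 2 <= sqnorm f * sqnorm (conv f (star k)).
  rewrite [X in X ^+ 2](_ : _ = inner f (conv (conv f (star k)) k)); last first.
    by rewrite /sqnorm inner_conv_adjoint// starK.
  apply: le_trans (cauchy_schwarz cO cf cfkk) _.
  by rewrite ler_wpM2l ?sqnorm_ge0//; have := k1 _ cfk; rewrite mul1r.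
have := sqnorm_ge0 cO cfk; have := sqnorm_ge0 cO cf.
set X := sqnorm (conv _ _); set Y := sqnorm f => Y0 X0.
by rewrite expr2 => XY; have [//|XY'] := leP X Y; nra.
Qed.

(** The inequality of the C*-identity that is not trivial, in the form which
    propagates the lower bound 1 on the norm from [k] to the powers of
    [conv k (star k)] whose exponents are powers of 2. *)
Lemma sqopnorm_conv_star k : continuous k ->
  (forall c, sqopnorm_le c k -> 1 <= c) ->
  forall c, sqopnorm_le c (conv k (star k)) -> 1 <= c.
Proof.
move=> ck k1 c kc; have cks := star_continuous ck.
pose d := Num.max c 0.
have d0 : 0 <= d by rewrite le_max lexx orbT.
suff : 1 <= d by rewrite le_max ler10 orbF.
rewrite -(@ler_sqrt _ 1)// sqrtr1; apply: k1 => f cf.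
have cfk := conv_continuous cO cf ck.
have cfkk := conv_continuous cO cfk cks.
have X0 := sqnorm_ge0 cO cfk; have Y0 := sqnorm_ge0 cO cf.
rewrite -(@ler_pXn2r _ 2) ?nnegrE ?mulr_ge0 ?sqrtr_ge0//.
have -> : sqnorm (conv f k) = inner f (conv (conv f k) (star k)).
  by rewrite {1}/sqnorm inner_conv_adjoint.
apply: le_trans (cauchy_schwarz cO cf cfkk) _.
rewrite exprMn sqr_sqrtr// expr2 mulrCA ler_wpM2l//.
rewrite convA//; apply: le_trans (kc f cf) _.
by rewrite ler_wpM2r// le_max lexx.
Qed.

Section power_limit.
Variable k : Omega -> R.
Hypotheses (ck : continuous k) (k_le : sqopnorm_le 1 k)
  (k_ge : forall c, sqopnorm_le c k -> 1 <= c).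

Let p := conv k (star k).

Fixpoint conv_power n := if n is n'.+1 then conv (conv_power n') p else p.

Local Notation pw := conv_power.

Let cks : continuous (star k). Proof. exact: star_continuous. Qed.

Let cp : continuous p. Proof. exact: conv_continuous. Qed.

Let cpw n : continuous (pw n).
Proof. by elim: n => [//|n IH] /=; exact: conv_continuous. Qed.

Let pwD n m : conv (pw n) (pw m) = pw (n + m).+1.
Proof.
elim: m => [|m IH]; first by rewrite addn0.
by rewrite /= -convA// IH addnS.
Qed.

Let star_pw n : star (pw n) = pw n.
Proof.
elim: n => [|n IH] /=; first by rewrite /p star_conv// starK.
by rewrite star_conv// IH (_ : star p = pw 0) ?pwD//= /p star_conv// starK.
Qed.

(* These traces are, alternately, the squared Hilbert-Schmidt norms of the powers
   [pw n] and of the powers followed by the contraction [k]; hence they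
   decrease. *)
Let a n := pw n 1%g.

Let inner_pw n m : inner (pw n) (pw m) = a (n + m).+1.
Proof. by rewrite inner_conv1 star_pw pwD. Qed.

Let a_odd n : a n.*2.+1 = sqnorm (pw n).
Proof. by rewrite /sqnorm inner_pw addnn. Qed.

Let a_even n : a n.*2.+2 = sqnorm (conv (pw n) k).
Proof.
have c1 := conv_continuous cO (cpw (n := n)) ck.
rewrite /sqnorm inner_conv1 star_conv// star_pw -convA// (convA cO _ ck)//.
rewrite -/p -[conv (pw n) p]/(pw n.+1).
by rewrite pwD addSn addnn.
Qed.

Let a_decr n : a n.+2 <= a n.+1.
Proof.
have [m [->|->]] : exists m, n = m.*2 \/ n = m.*2.+1.
  by exists n./2; case: (odd n) (odd_double_half n) => e;
    [right|left]; rewrite -[LHS]e.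
- by rewrite a_odd a_even; have := k_le (cpw (n := m)); rewrite mul1r.
- rewrite a_even -doubleS a_odd /= /p -convA//.
  have := sqopnorm_le_star ck k_le (conv_continuous cO (cpw (n := m)) ck).
  by rewrite mul1r.
Qed.

Let a_decrD n m : a (n + m).+1 <= a n.+1.
Proof.
by elim: m => [|m IH]; [rewrite addn0|rewrite addnS; exact: le_trans (a_decr _) IH].
Qed.

Let pw_ge1 j : exists2 n, (j <= n)%N & forall c, sqopnorm_le c (pw n) -> 1 <= c.
Proof.
elim: j => [|j [n jn IH]].
  by exists 0%N => // c; exact: sqopnorm_conv_star.
exists n.*2.+1; first by rewrite ltnS -addnn (leq_trans jn)// leq_addr.
by move=> c; rewrite -addnn -pwD -[in X in conv _ X]star_pw; exact: sqopnorm_conv_star.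
Qed.

Let a_ge1 n : 1 <= a n.+1.
Proof.
have [m nm pm] := pw_ge1 n.
apply: (@le_trans _ _ (a m.*2.+1)); last first.
  by rewrite -addnn -(subnKC nm) -addnA; exact: a_decrD.
rewrite a_odd; apply: pm => f cf; rewrite mulrC -[in leRHS]star_pw.
exact: sqnorm_conv_le.
Qed.

Let sqnorm_pw_sub n m :
  sqnorm (fun x => pw n x - pw m x) = a n.*2.+1 - 2 * a (n + m).+1 + a m.*2.+1.
Proof.
have := sqnorm_sub cO 1 (cpw (n := n)) (cpw (n := m)).
rewrite !mulr1 expr1n mul1r inner_pw -!a_odd => <-.
by congr sqnorm; apply/funext => x; rewrite mul1r.
Qed.

Let a_cauchy e : 0 < e -> exists N, forall n m, (N <= n)%N -> (N <= m)%N ->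
  `|a n.+1 - a m.+1| <= e.
Proof.
move=> e0; have : cvgn (fun n => a n.+1).
  apply: nonincreasing_is_cvgn.
    by move=> n m nm; rewrite -(subnKC nm); exact: a_decrD.
  by exists 1 => _ [n _ <-]; exact: a_ge1.
move=> /cvgrPdist_le/(_ (e / 2) ltac:(lra))[N _ HN]; exists N => n m Nn Nm.
have := HN n Nn; have := HN m Nm; rewrite /= !ler_norml; lra.
Qed.

Let pw_lim : exists2 q, continuous q & uniform_lim pw q.
Proof.
have [|q uq] := @uniform_cauchy_lim _ _ (fun n => pw n.+1).
  move=> e e0; pose C := sqnorm (star p) + 1.
  have C0 : 0 < C by have := sqnorm_ge0 cO (star_continuous cp); rewrite /C; lra.
  have [N HN] := a_cauchy (e := e ^+ 2 / (2 * C))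
    ltac:(by rewrite divr_gt0 ?exprn_gt0//; lra).
  exists N => n m Nn Nm x.
  rewrite -(@ler_pXn2r _ 2) ?nnegrE ?(ltW e0)// real_normK ?num_real//.
  have cd : continuous (fun x => pw n x - pw m x).
    by have cn := cpw (n := n); have cm := cpw (n := m); cont.
  have -> : pw n.+1 x - pw m.+1 x = conv (fun x => pw n x - pw m x) p x.
    by rewrite convBl.
  apply: le_trans (conv_sup_le cO _ cd cp) _; rewrite sqnorm_pw_sub.
  have le2 i j : (N <= i)%N -> (N <= j)%N -> (N <= i + j)%N.
    by move=> Ni _; exact: leq_trans (leq_addr _ _).
  have := HN _ _ (le2 _ _ Nn Nn) (le2 _ _ Nn Nm).
  have := HN _ _ (le2 _ _ Nm Nm) (le2 _ _ Nn Nm).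
  rewrite !addnn !ler_norml; set d := e ^+ 2 / (2 * C).
  have -> : e ^+ 2 = 2 * d * C by rewrite /d; field; rewrite gt_eqF.
  move=> /andP[_ d1] /andP[_ d2].
  apply: ler_pM; [|exact/sqnorm_ge0/star_continuous| |].
  - by rewrite -sqnorm_pw_sub; exact: sqnorm_ge0.
  - lra.
  - by rewrite /C; lra.
have uq' : uniform_lim pw q.
  move=> e e0; have [N uN] := uq e e0; exists N.+1 => -[//|n] Nn; exact: uN.
by exists q => //; exact: (uniform_lim_continuous cpw uq').
Qed.

(** The positive operator with kernel [conv k (star k)] has norm 1, and its powers
    decrease to the projection onto its eigenspace for the eigenvalue 1.
    The values at 1 of the kernels are their traces; they control the
    distances between the powers in the Hilbert-Schmidt norm, so that the
    kernels converge. *)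
Lemma conv_power_limit : exists q,
  [/\ continuous q, conv q q = q, star q = q, conv (conv k (star k)) q = q
    & 1 <= q 1%g].
Proof.
have [q cq uq] := pw_lim.
have starq : star q = q.
  apply/funext => x; apply/eqP.
  have uqs : uniform_lim pw (star q).
    move=> e e0; have [N uN] := uq e e0; exists N => n Nn y.
    by rewrite -star_pw; exact: uN.
  by rewrite (uniform_lim_unique uqs uq).
have qpw m : conv q (pw m) = q.
  apply: (uniform_lim_unique (uniform_lim_convl cpw (cpw (n := m)) uq)).
  have -> : (fun n => conv (pw n) (pw m)) = (fun n => pw (n + m.+1)%N).
    by apply/funext => n; rewrite pwD addnS.
  exact: uniform_lim_shift.
have pwq m : conv (pw m) q = q.
  by have := congr1 (@star R Omega) (qpw m); rewrite star_conv// starq star_pw.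
exists q; split=> //.
- apply: (uniform_lim_unique (uniform_lim_convl cpw cq uq)).
  have -> : (fun n => conv (pw n) q) = (fun _ => q) by apply/funext => n.
  by move=> e e0; exists 0%N => n _ x; rewrite subrr normr0 ltW.
- exact: (pwq 0%N).
- apply: (@uniform_lim_ge _ _ (fun n => pw (n + 1)%N) q).
    exact: uniform_lim_shift.
  by move=> n; rewrite addn1; exact: a_ge1.
Qed.

End power_limit.

End projection.

(** * Matrix coefficients are dense *)

Section coefficients.
Context (R : realType) (Omega : topGroupType).
Hypothesis cO : compact [set: Omega].
Implicit Types (f g h k q : Omega -> R) (w x y : Omega).

Record orthogonal_rep n (rho : Omega -> 'M[R]_n) : Prop := OrthogonalRep {
  orep_continuous : forall i j, continuous (fun w => rho w i j) ;
  orep1 : rho 1%g = 1%:M ;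
  orepM : forall w w', rho (w * w')%g = rho w *m rho w' ;
  orep_orthogonal : forall w, rho w *m (rho w)^T = 1%:M
}.

(** Generated inductively, one coefficient at a time, as the representations in a
    sum have different dimensions. *)
Inductive coef_span : (Omega -> R) -> Prop :=
| coef_span0 : coef_span (fun _ => 0)
| coef_span_cons n (rho : Omega -> 'M[R]_n) i j c f : orthogonal_rep rho ->
    coef_span f -> coef_span (fun w => c * rho w i j + f w).

Lemma coef_spanD f g : coef_span f -> coef_span g ->
  coef_span (fun w => f w + g w).
Proof.
move=> + sg; elim=> [|n rho i j c {}f rrho sf IH].
  by under eq_fun do rewrite add0r.
by under eq_fun do rewrite -addrA; exact: coef_span_cons.
Qed.

Lemma coef_spanZ c f : coef_span f -> coef_span (fun w => c * f w).
Proof.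
elim=> [|n rho i j d {}f rrho sf IH].
  by under eq_fun do rewrite mulr0; exact: coef_span0.
by under eq_fun do rewrite mulrDr mulrA; exact: coef_span_cons.
Qed.

Lemma coef_span_sum n (F : 'I_n -> Omega -> R) :
  (forall i, coef_span (F i)) -> coef_span (fun w => \sum_i F i w).
Proof.
elim: n F => [|n IH] F sF.
  by under eq_fun do rewrite big_ord0; exact: coef_span0.
under eq_fun do rewrite big_ord_recl.
by apply: coef_spanD => //; apply: IH.
Qed.

Lemma coef_span_coef n (rho : Omega -> 'M[R]_n) i j :
  orthogonal_rep rho -> coef_span (fun w => rho w i j).
Proof.
move=> rrho; have := coef_span_cons i j 1 rrho coef_span0.
by under eq_fun do rewrite mul1r addr0.
Qed.

Lemma coef_span_continuous f : coef_span f -> continuous f.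
Proof.
elim=> [|n rho i j c {}f rrho sf IH]; first by cont.
by have := @orep_continuous _ _ rrho i j => cr; cont.
Qed.

Lemma conv_suml n (F : 'I_n -> Omega -> R) g : (forall i, continuous (F i)) ->
  continuous g ->
  conv (fun x => \sum_i F i x) g = fun x => \sum_i conv (F i) g x.
Proof.
move=> cF cg; apply/funext => x; rewrite /conv -haar_sum//; last by cont.
by congr haar; apply/funext => y; rewrite mulr_suml.
Qed.

Lemma conv_translate f g w x : continuous f -> continuous g ->
  conv (fun y => f (w * y)%g) g x = conv f g (w * x)%g.
Proof.
move=> cf cg; rewrite /conv.
rewrite -(@haar_translate _ _ cO (fun y => f y * g (y^-1 * (w * x))%g) w); last by cont.
by congr haar; apply/funext => y; rewrite invgM mulgA mulgVK.
Qed.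

Lemma conv_coef_span f g : coef_span f -> continuous g -> coef_span (conv f g).
Proof.
move=> + cg; elim=> [|n rho i j c {}f rrho sf IH].
  rewrite (_ : conv _ g = fun _ => 0); first exact: coef_span0.
  apply/funext => x; rewrite -[RHS](haar_cst cO) /conv; congr haar.
  by apply/funext => y; rewrite mul0r.
have cf := coef_span_continuous sf; have crho := @orep_continuous _ _ rrho.
have cij := crho i j.
rewrite convDl//; last by cont.
apply: coef_spanD => //; rewrite convZl//; apply: coef_spanZ.
have cil l : continuous (fun w => rho w l j) by exact: crho.
have -> : conv (fun w => rho w i j) g =
    fun w => \sum_l conv (fun w => rho w l j) g 1%g * rho w i l.
  apply/funext => w; rewrite -[in LHS](mulg1 w) -(conv_translate w 1%g cij cg).
  rewrite (_ : (fun y => rho _ i j) = fun y => \sum_l rho w i l * rho y l j).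
    rewrite conv_suml//; last by move=> l; cont.
    by apply: eq_bigr => l _; rewrite convZl// mulrC.
  by apply/funext => y; rewrite (orepM rrho) mxE.
apply: coef_span_sum => l; apply: coef_spanZ; exact: coef_span_coef.
Qed.

Section range_of_projection.
Variable q : Omega -> R.
Hypotheses (cq : continuous q) (qq : conv q q = q).

Let V f := continuous f /\ conv f q = f.

(** Only the functions [e i] with [i < d] matter; indexing them by the natural
    numbers makes it easy to add one more. *)
Definition orthonormal_family d (e : nat -> Omega -> R) :=
  [/\ forall i, continuous (e i), forall i, (i < d)%N -> conv (e i) q = e i
    & forall i j, (i < d)%N -> (j < d)%N -> inner (e i) (e j) = (i == j)%:R].

Let inner_lin d e (c : nat -> R) i : orthonormal_family d e -> (i < d)%N ->
  inner (fun x => \sum_(j < d) c j * e j x) (e i) = c i.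
Proof.
move=> [ce _ oe] id; have cF j : continuous (fun x => c j * e j x) by cont.
rewrite (inner_suml cO _ cF)// (bigD1 (Ordinal id))//= innerZl// oe// eqxx mulr1.
rewrite big1 ?addr0// => j ji; rewrite innerZl// oe//.
by move: ji; rewrite -val_eqE /= => /negPf ->; rewrite mulr0.
Qed.

Let V_lin d e (c : nat -> R) : orthonormal_family d e ->
  V (fun x => \sum_(j < d) c j * e j x).
Proof.
move=> [ce qe _]; split; first by cont.
rewrite conv_suml//; last by cont.
by apply/funext => x; apply: eq_bigr => i _; rewrite convZl// qe.
Qed.

Let sqnorm_lin d e (c : nat -> R) : orthonormal_family d e ->
  sqnorm (fun x => \sum_(j < d) c j * e j x) = \sum_(j < d) c j ^+ 2.
Proof.
move=> oe; have [ce _ _] := oe.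
have cF j : continuous (fun x => c j * e j x) by cont.
rewrite /sqnorm (inner_suml cO _ cF)//; last by have [] := V_lin c oe.
by apply: eq_bigr => i _; rewrite innerZl//; [rewrite innerC inner_lin// expr2|
  have [] := V_lin c oe].
Qed.

(** Evaluation at a point is bounded on the range of the projection, by the
    Hilbert-Schmidt norm of the kernel; hence the integral of the sum of the
    squares of [d] orthonormal functions, which is [d], is bounded too. *)
Lemma orthonormal_family_bounded d e : orthonormal_family d e ->
  d%:R <= sqnorm (star q).
Proof.
move=> oe; have [ce _ onb] := oe.
have C0 := sqnorm_ge0 cO (star_continuous cq).
have bessel x : \sum_(i < d) e i x ^+ 2 <= sqnorm (star q).
  have [ch hq] := V_lin (fun i => e i x) oe.
  have := conv_sup_le cO x ch cq; rewrite hq (sqnorm_lin (fun i => e i x) oe) /=.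
  have -> : \sum_(j < d) e j x * e j x = \sum_(i < d) e i x ^+ 2.
    by apply: eq_bigr => i _; rewrite expr2.
  set s := \sum_(i < d) _.
  have s0 : 0 <= s by apply: sumr_ge0 => i _; rewrite sqr_ge0.
  by move: C0; set C := sqnorm _ => C0; have [//|Cs] := leP s C; nra.
have -> : d%:R = haar (fun x => \sum_(i < d) e i x ^+ 2).
  rewrite haar_sum//; last by cont.
  under eq_bigr => i _.
    rewrite (_ : haar _ = 1); first over.
    by have := onb i i (ltn_ord i) (ltn_ord i); rewrite eqxx.
  by rewrite sumr_const card_ord.
rewrite -[leRHS](haar_cst cO); apply: haar_le => //; cont.
Qed.

(** Gram-Schmidt: a function of the range outside the span of an orthonormal
    family enlarges the family, which cannot go on beyond the bound above. *)
Lemma finite_orthonormal_basis : exists d e, orthonormal_family d e /\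
  forall f, V f -> f = fun x => \sum_(i < d) inner f (e i) * e i x.
Proof.
apply: contrapT => nobasis.
suff all_d d : exists e, orthonormal_family d e.
  have := archi_boundP (sqnorm_ge0 cO (star_continuous cq)).
  set d := Num.Def.archi_bound _ => Cd.
  by have [e /orthonormal_family_bounded] := all_d d; rewrite leNgt Cd.
elim: d => [|d [e oe]]; first by exists (fun _ _ => 0); split=> // i; cont.
apply: contrapT => noext; apply: nobasis; exists d, e; split=> // f [cf fq].
have [ce qe onb] := oe; have [cs sq] := V_lin (fun i => inner f (e i)) oe.
pose s x := \sum_(i < d) inner f (e i) * e i x.
pose r x := f x - s x.
have cr : continuous r by rewrite /r /s; cont.
have rq : conv r q = r by rewrite /r convBl// fq sq.
have r_orth i : (i < d)%N -> inner r (e i) = 0.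
  move=> id; rewrite /r innerDl//; last by cont.
  rewrite (_ : (fun x => - s x) = fun x => -1 * s x).
    by rewrite innerZl// (inner_lin (fun i => inner f (e i)) oe)// mulN1r subrr.
  by apply/funext => x; rewrite mulN1r.
have [r0|r0] := eqVneq (sqnorm r) 0.
  apply/funext => x; apply/eqP; rewrite -subr_eq0 -sqrf_eq0 eq_le sqr_ge0 andbT.
  by have := conv_sup_le cO x cr cq; rewrite rq r0 mul0r.
have rpos : 0 < sqnorm r by rewrite lt_neqAle eq_sym r0 sqnorm_ge0.
case: noext; pose c := (Num.sqrt (sqnorm r))^-1.
have c2 : c ^+ 2 * sqnorm r = 1.
  by rewrite exprVn sqr_sqrtr ?mulVf// ltW.
exists (fun i => if i == d then (fun x => c * r x) else e i); split.
- by move=> i; case: eqP => _ //; cont.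
- move=> i; rewrite ltnS leq_eqVlt; case: eqP => [_ _|_ /= id].
    by rewrite convZl// rq.
  exact: qe.
- move=> i j; rewrite !ltnS (leq_eqVlt i) (leq_eqVlt j).
  case: (eqVneq i d) => [->|id] /=; case: (eqVneq j d) => [->|jd] //=.
  + by move=> _ _; rewrite -[inner _ _]/(sqnorm _) sqnormZ ?eqxx.
  + by move=> _ jd'; rewrite innerZl// r_orth// mulr0.
  + by move=> id' _; rewrite innerC innerZl// r_orth// mulr0 (negPf id).
  + exact: onb.
Qed.

(** Left translations commute with the convolution by [q] from the right, hence
    act on its finite-dimensional range, by orthogonal matrices. *)
Lemma coef_span_projection : coef_span q.
Proof.
have [d [e [oe basis]]] := finite_orthonormal_basis.
have [ce qe onb] := oe.
(* The entries are indexed by natural numbers like the functions [e i], so that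
   rows of the matrix can serve as coefficients in [inner_lin]. *)
pose r w i j := inner (fun x => e i (w * x)%g) (e j).
pose rho w : 'M[R]_d := \matrix_(i, j) r w i j.
have ceT i w : continuous (fun x => e i (w * x)%g) by have ci := ce i; cont.
have ew i w x : (i < d)%N -> e i (w * x)%g = \sum_(j < d) r w i j * e j x.
  move=> id; have /basis/(congr1 (@^~ x))// : V (fun x => e i (w * x)%g).
  by split=> //; apply/funext => y; rewrite conv_translate// qe.
have rrho : orthogonal_rep rho.
  split.
  - move=> i j; under eq_fun do rewrite mxE.
    have ci := ce i; have cj := ce j.
    by apply: (@haar_param_continuous _ _ cO _ (fun w x => e i (w * x)%g * e j x)); cont.
  - apply/matrixP => i j; rewrite !mxE /r.
    by under eq_fun do rewrite mul1g; exact: onb.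
  - move=> w w'; apply/matrixP => i j; rewrite !mxE {1}/r.
    have -> : (fun x => e i (w * w' * x)%g) = fun x => \sum_(l < d)
        (\sum_(k < d) r w i k * r w' k l) * e l x.
      apply/funext => x; rewrite -mulgA ew//.
      under eq_bigr => k _ do rewrite ew// mulr_sumr.
      rewrite exchange_big/=; apply: eq_bigr => l _.
      by rewrite mulr_suml; apply: eq_bigr => k _; rewrite mulrA.
    rewrite (inner_lin (fun l => \sum_(k < d) r w i k * r w' k l) oe)//.
    by apply: eq_bigr => k _; rewrite !mxE.
  - move=> w; apply/matrixP => i j; rewrite !mxE.
    have <- : inner (fun x => e i (w * x)%g) (fun x => e j (w * x)%g) = (i == j)%:R.
      rewrite -(onb i j)//; apply: (@haar_translate _ _ cO (fun x => e i x * e j x)).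
      by have ci := ce i; have cj := ce j; cont.
    have -> : (fun x => e i (w * x)%g) = fun x => \sum_(k < d) r w i k * e k x.
      by apply/funext => x; rewrite ew.
    rewrite (@inner_suml _ _ cO d (fun l x => r w i l * e l x))//; last by cont.
    by apply: eq_bigr => k _; rewrite innerZl// innerC !mxE.
rewrite (basis q (conj cq qq)); apply: coef_span_sum => i; apply: coef_spanZ.
have -> : e i = fun w => \sum_(j < d) e j 1%g * rho w i j.
  apply/funext => w; rewrite -[in LHS](mulg1 w) ew//.
  by apply: eq_bigr => j _; rewrite !mxE mulrC.
apply: coef_span_sum => j; apply: coef_spanZ; exact: coef_span_coef.
Qed.

End range_of_projection.

Lemma sqopnorm_leW c c' k : c <= c' -> sqopnorm_le c k -> sqopnorm_le c' k.
Proof.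
move=> cc' kc f cf; apply: le_trans (kc f cf) _.
by rewrite ler_wpM2r// sqnorm_ge0.
Qed.

Lemma sqopnormP k : continuous k -> exists c, [/\ 0 <= c, sqopnorm_le c k &
  forall c', 0 <= c' -> sqopnorm_le c' k -> c <= c'].
Proof.
move=> ck; pose S := [set c | 0 <= c /\ sqopnorm_le c k].
have S0 : S !=set0.
  exists (sqnorm (star k)); split; first exact/sqnorm_ge0/star_continuous.
  by move=> f cf; rewrite mulrC; exact: sqnorm_conv_le.
have lbS : has_lbound S by exists 0 => c [].
exists (inf S); split.
- by apply: lb_le_inf => // c [].
- move=> f cf; have := sqnorm_ge0 cO cf.
  rewrite le_eqVlt => /orP[/eqP f0|f0].
    by case: S0 => c [_ /(_ f cf)]; rewrite -f0 !mulr0.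
  rewrite -ler_pdivrMr//; apply: lb_le_inf => // c [_ /(_ f cf)].
  by rewrite ler_pdivrMr.
- by move=> c c0 kc; exact: ge_inf.
Qed.

(** If [t] in the span of the coefficients is almost the best approximation of
    [f] for the L2 norm, then [f - t] has a small operator norm: otherwise,
    removing from [f - t] its part on the top eigenspace would give a better
    approximation. *)
Lemma coef_span_approx f (e : R) : continuous f -> 0 < e ->
  exists2 t, coef_span t & sqopnorm_le e (fun x => f x - t x).
Proof.
move=> cf e0; pose S := [set sqnorm (fun x => f x - t x) | t in coef_span].
have csub t : coef_span t -> continuous (fun x => f x - t x).
  by move=> /coef_span_continuous ct; cont.
have infS : has_inf S.
  split.
    by exists (sqnorm (fun x => f x - 0)), (fun _ => 0) => //; exact: coef_span0.
  by exists 0 => _ [t st <-]; apply: sqnorm_ge0 => //; exact: csub.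
have [_ [t st <-] te] := inf_adherent e0 infS.
exists t => //; have cg := csub t st; set g := (fun x => f x - t x) in cg te *.
have [L [L0 gL Lmin]] := sqopnormP cg.
have [Le|eL] := leP L e; first exact: sqopnorm_leW gL.
have L1 : 0 < L by exact: lt_trans eL.
pose l := Num.sqrt L; have l2 : l ^+ 2 = L by rewrite sqr_sqrtr.
have l0 : 0 < l by rewrite sqrtr_gt0.
pose k x := l^-1 * g x; have ck : continuous k by rewrite /k; cont.
have gk : g = fun x => l * k x.
  by apply/funext => x; rewrite /k mulrA mulfV ?mul1r// gt_eqF.
have convk h : continuous h ->
    sqnorm (conv h g) = L * sqnorm (conv h k).
  by move=> ch; rewrite gk convZr// sqnormZ ?l2//; exact: conv_continuous.
have k_le : sqopnorm_le 1 k.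
  by move=> h ch; rewrite mul1r -(ler_pM2l L1) -convk//; exact: gL.
have k_ge c : sqopnorm_le c k -> 1 <= c.
  move=> kc; have : 1 <= Num.max c 0.
    have c0 : 0 <= Num.max c 0 by rewrite le_max lexx orbT.
    rewrite -(ler_pM2l L1) mulr1; apply: Lmin; first by rewrite mulr_ge0.
    move=> h ch; rewrite convk// -mulrA ler_pM2l//.
    by apply: sqopnorm_leW kc _ ch; rewrite le_max lexx.
  by rewrite le_max ler10 orbF.
have [q [cq qq starq pq q1]] := conv_power_limit cO ck k_le k_ge.
have sqk : coef_span (conv q k).
  by apply: conv_coef_span => //; exact: coef_span_projection.
have cqk := coef_span_continuous sqk; have cks := star_continuous ck.
have inner_k : inner k (conv q k) = q 1%g.
  by rewrite inner_conv1 star_conv// starq -convA// pq.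
have sqnorm_qk : sqnorm (conv q k) = q 1%g.
  rewrite /sqnorm inner_conv1 star_conv// starq convA//; last exact: conv_continuous.
  by rewrite -(convA cO ck)// pq qq.
pose t' x := t x + l * conv q k x.
have st' : coef_span t' by apply: coef_spanD => //; exact: coef_spanZ.
have : inf S <= sqnorm (fun x => f x - t' x).
  by apply: ge_inf; [exact: (proj2 infS)|exists t'].
have -> : (fun x => f x - t' x) = fun x => g x - l * conv q k x.
  by apply/funext => x; rewrite /t' /g opprD addrA.
rewrite sqnorm_sub// gk innerZl// -gk inner_k sqnorm_qk l2.
have -> : 2 * l * (l * q 1%g) = 2 * L * q 1%g by rewrite -l2; ring.
nra.
Qed.

End coefficients.

(** * Approximation by sums of products of functions and coefficients *)

Section tensor.
Context (R : realType) (K : topologicalType) (Omega : topGroupType).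
Hypotheses (cK : compact [set: K]) (cO : compact [set: Omega])
  (hO : hausdorff_space Omega).

Inductive tensor_span : (K -> Omega -> R) -> Prop :=
| tensor_span0 : tensor_span (fun _ _ => 0)
| tensor_span_cons n (rho : Omega -> 'M[R]_n) i j (h : K -> R) F : orthogonal_rep rho ->
    continuous h -> tensor_span F ->
    tensor_span (fun x w => h x * rho w i j + F x w).

Lemma tensor_spanD F F' : tensor_span F -> tensor_span F' ->
  tensor_span (fun x w => F x w + F' x w).
Proof.
move=> + sF'; elim=> [|n rho i j h {}F rrho ch sF IH].
  by under eq2_fun do rewrite add0r.
by under eq2_fun do rewrite -addrA; exact: tensor_span_cons.
Qed.

Lemma tensor_span_sum n (F : 'I_n -> K -> Omega -> R) :
  (forall i, tensor_span (F i)) -> tensor_span (fun x w => \sum_i F i x w).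
Proof.
elim: n F => [|n IH] F sF.
  by under eq2_fun do rewrite big_ord0; exact: tensor_span0.
under eq2_fun do rewrite big_ord_recl.
by apply: tensor_spanD => //; apply: IH.
Qed.

(** As [rho (y^-1 * w)] is the product of [rho y^-1] and [rho w], convolving with a
    coefficient separates the variables: the integrals of [F x] against the
    entries of [rho y^-1] are the functions of [x]. *)
Lemma conv_tensor_span (F : K -> Omega -> R) t :
  continuous (fun p : K * Omega => F p.1 p.2) -> coef_span t ->
  tensor_span (fun x => conv (F x) t).
Proof.
move=> cF; have cFx x : continuous (F x).
  by have : continuous (fun w => F x w) by cont.
elim=> [|n rho i j c f rrho sf IH].
  rewrite (_ : (fun x => _) = fun _ _ => 0); first exact: tensor_span0.
  apply/funext => x; apply/funext => w; rewrite -[RHS](haar_cst cO) /conv.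
  by congr haar; apply/funext => y; rewrite mulr0.
have cf := coef_span_continuous sf; have crho := @orep_continuous _ _ _ _ rrho.
have cij := crho i j.
rewrite (_ : (fun x => _) = fun x w =>
  \sum_l (c * haar (fun y => F x y * rho y^-1%g i l)) * rho w l j + conv (F x) f w).
  apply: tensor_spanD => //; apply: tensor_span_sum => l.
  have cil := crho i l.
  have ch : continuous (fun x => c * haar (fun y => F x y * rho y^-1%g i l)).
    have ch' : continuous (fun x => haar (fun y => F x y * rho y^-1%g i l)).
      pose r w := rho w i l; have cr : continuous r by [].
      by apply: (@haar_param_continuous _ _ cO _ (fun x y => F x y * r y^-1%g)); cont.
    by cont.
  have := tensor_span_cons l j rrho ch tensor_span0.
  by under eq2_fun do rewrite addr0.
apply/funext => x; rewrite convDr//; last by cont.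
apply/funext => w; congr (_ + _); rewrite convZr// /conv.
have -> : (fun y => F x y * rho (y^-1 * w)%g i j) =
    fun y => \sum_l F x y * rho y^-1%g i l * rho w l j.
  apply/funext => y; rewrite (orepM rrho) mxE mulr_sumr.
  by apply: eq_bigr => l _; rewrite mulrA.
have cFx' := cFx x.
have cl l : continuous (fun y => F x y * rho y^-1%g i l).
  by pose r w := rho w i l; have cr : continuous r := crho i l;
    have : continuous (fun y => F x y * r y^-1%g) by cont.
rewrite haar_sum//; last by move=> l; have cll := cl l; cont.
rewrite mulr_sumr; apply: eq_bigr => l _; rewrite -mulrA; congr (_ * _).
by under eq_fun do rewrite mulrC; rewrite haarZ// mulrC.
Qed.

Lemma bump_function (U : set Omega) : nbhs 1%g U -> exists psi : Omega -> R,
  [/\ continuous psi, forall x, 0 <= psi x, haar psi = 1 &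
    forall x, psi x != 0 -> U x].
Proof.
rewrite nbhsE => -[V [oV V1] VU].
have c1 : closed [set (1%g : Omega)].
  by apply: accessible_closed_set1; exact: hausdorff_accessible.
have sep : uniform_separator (~` V) [set (1%g : Omega)].
  move: (compact_normal hO cO) => /(normal_separatorP (R := R)); apply.
  - exact: open_closedC.
  - exact: c1.
  - by apply/seteqP; split=> // x [nVx x1]; apply: nVx; rewrite x1.
pose f : Omega -> R := Urysohn (~` V) [set (1%g : Omega)].
have cf : continuous f by exact: Urysohn_continuous.
have f0 x : 0 <= f x.
  have /= := @Urysohn_range _ R (~` V) [set (1%g : Omega)] (f x).
  by rewrite in_itv/= => /(_ (ex_intro2 _ _ x I erefl))/andP[].
have f1 : f 1%g = 1.
  by apply: (Urysohn_sub1 sep); exists 1%g.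
have fV x : f x != 0 -> V x.
  apply: contraNP => nVx; apply/eqP; apply: (Urysohn_sub0 sep).
  by exists x.
have hf : 0 < haar f.
  pose W := [set x | 2^-1 <= f x].
  apply: (@haar_gt0 _ _ cO _ (2^-1) W) => //.
  have /cvgrPdist_le/(_ 2^-1 ltac:(by rewrite invr_gt0)) := cf 1%g.
  by apply: filterS => x; rewrite f1 ler_norml /W/=; lra.
exists (fun x => (haar f)^-1 * f x); split.
- by cont.
- by move=> x; rewrite mulr_ge0// invr_ge0 ltW.
- by rewrite haarZ// mulVf// gt_eqF.
- by move=> x; rewrite mulf_eq0 negb_or => /andP[_ /fV/VU].
Qed.

(** The left-hand side is the average of [F (w * y)] with weight [psi y]. *)
Lemma conv_star_close (F : Omega -> R) (psi : Omega -> R) (c : R) w e :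
  continuous F -> continuous psi -> (forall x, 0 <= psi x) -> haar psi = 1 ->
  (forall y, psi y != 0 -> `|F (w * y)%g - c| <= e) ->
  `|conv F (star psi) w - c| <= e.
Proof.
move=> cF cpsi psi0 psi1 Fc.
have -> : conv F (star psi) w = haar (fun y => F (w * y)%g * psi y).
  rewrite /conv -(@haar_translate _ _ cO _ w); last by rewrite /star; cont.
  congr haar; apply/funext => y; rewrite /star.
  by rewrite invgM invgK mulKg.
have -> : c = haar (fun y => c * psi y) by rewrite haarZ// psi1 mulr1.
rewrite -haarB//; [|by cont|by cont].
have -> : (fun y => F (w * y)%g * psi y - c * psi y) =
    fun y => (F (w * y)%g - c) * psi y.
  by apply/funext => y; rewrite mulrBl.
have He : haar (fun y => e * psi y) = e by rewrite haarZ// psi1 mulr1.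
have bnd y : `|(F (w * y)%g - c) * psi y| <= e * psi y.
  have [->|/Fc H] := eqVneq (psi y) 0; first by rewrite !mulr0 normr0.
  by rewrite normrM (ger0_norm (psi0 y)) ler_wpM2r.
rewrite ler_norml; apply/andP; split; rewrite -He -?haarN//; try cont.
  apply: haar_le => //; try cont.
  by move=> y; have := bnd y; rewrite ler_norml => /andP[].
apply: haar_le => //; try cont.
by move=> y; have := bnd y; rewrite ler_norml => /andP[].
Qed.

(** Convolution with a bump function changes [F] little, and so does the
    second one, whose role is to turn the smallness in operator norm of the
    difference between the bump function and a sum of coefficients into a
    uniform bound. *)
Lemma tensor_span_dense (F : K -> Omega -> R) e :
  continuous (fun p : K * Omega => F p.1 p.2) -> 0 < e ->
  exists2 G, tensor_span G & forall x w, `|F x w - G x w| <= e.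
Proof.
move=> cF e0; have cFx x : continuous (F x).
  by have : continuous (fun w => F x w) by cont.
have cKO := compact_setX cK cO; rewrite setXTT in cKO.
have cH : continuous (fun q : (K * Omega) * Omega => F q.1.1 (q.1.2 * q.2)%g).
  by cont.
have d0 : 0 < e / 3 by lra.
have := @compact_uniform_near R _ _ (fun q h => F q.1 (q.2 * h)%g) 1%g
  (e / 3) cKO cH d0.
move=> /bump_function[psi [cpsi psi0 psi1 psiU]].
have cphi := star_continuous cpsi; set phi := star psi in cphi.
have [M FM] := compact_continuous_bounded cKO cF.
have C0 := sqnorm_ge0 cO cpsi; set C := sqnorm psi in C0.
have M2 := sqr_ge0 M.
have [t st tphi] := @coef_span_approx _ _ cO phi ((e / 3) ^+ 2 / (M ^+ 2 * C + 1))
  cphi ltac:(by rewrite divr_gt0 ?exprn_gt0// ltr_wpDl// mulr_ge0).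
have ct := coef_span_continuous st.
have stphi : coef_span (conv t phi) by exact: conv_coef_span.
exists (fun x => conv (F x) (conv t phi)); first exact: conv_tensor_span.
move=> x w; have cFx' := cFx x.
have step1 u : `|conv (F x) phi u - F x u| <= e / 3.
  apply: conv_star_close => // y /psiU /(_ (x, u)) /=.
  by rewrite mulg1.
have cFphi : continuous (conv (F x) phi) by exact: conv_continuous.
have cFt : continuous (conv (F x) t) by exact: conv_continuous.
have step2 : `|conv (conv (F x) phi) phi w - conv (F x) phi w| <= e / 3.
  have -> : conv (conv (F x) phi) phi w - conv (F x) phi w =
      conv (fun u => conv (F x) phi u - F x u) phi w - 0.
    by rewrite convBl// subr0.
  apply: conv_star_close => //; first by cont.
  by move=> y _; rewrite subr0.
have step3 : `|conv (conv (F x) phi) phi w - conv (F x) (conv t phi) w| <= e / 3.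
  rewrite -convA//.
  have -> : conv (conv (F x) phi) phi w - conv (conv (F x) t) phi w =
      conv (conv (F x) (fun u => phi u - t u)) phi w.
    by rewrite convBr// convBl.
  have ctp : continuous (fun u => phi u - t u) by cont.
  rewrite -(@ler_pXn2r _ 2) ?nnegrE ?(ltW d0)// real_normK ?num_real//.
  apply: le_trans (conv_sup_le cO _ (conv_continuous cO cFx' ctp) cphi) _.
  rewrite starK -/C.
  apply: (@le_trans _ _ ((e / 3) ^+ 2 / (M ^+ 2 * C + 1) * M ^+ 2 * C)).
    rewrite ler_wpM2r//; apply: le_trans (tphi _ cFx') _.
    rewrite ler_wpM2l//; first by rewrite divr_ge0 ?sqr_ge0// addr_ge0// mulr_ge0.
    apply: sqnorm_le => // y; have := FM (x, y) => /= Fy.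
    by rewrite -[F x y ^+ 2]real_normK ?num_real// ler_pXn2r// nnegrE (le_trans _ Fy).
  have D0 : 0 < M ^+ 2 * C + 1 by rewrite ltr_wpDl// mulr_ge0.
  rewrite -mulrA mulrAC ler_pdivrMr// ler_wpM2l ?sqr_ge0//.
  by rewrite lerDl.
have := step1 w; move: step2 step3; rewrite !ler_norml; lra.
Qed.

End tensor.

(** * Completeness of the spaces of continuous functions *)

Section completeness.
Context (R : realType).

Definition seq_complete (V : normedModType R[i]) := forall w : nat -> V,
  (forall e : R[i], 0 < e -> exists N, forall n m,
    (N <= n)%N -> (N <= m)%N -> `|w n - w m| <= e) ->
  exists v, forall e : R[i], 0 < e -> exists N, forall n,
    (N <= n)%N -> `|w n - v| <= e.

Lemma posc_eq (e : R[i]) : 0 < e -> exists2 d : R, 0 < d & e = d%:C.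
Proof.
move=> e0; have eR : e = (complex.Re e)%:C by rewrite RRe_real// gtr0_real.
by exists (complex.Re e) => //; move: e0; rewrite {1}eR ltcR.
Qed.

Lemma posc_min (e1 e2 : R[i]) : 0 < e1 -> 0 < e2 ->
  exists2 e, 0 < e & e <= e1 /\ e <= e2.
Proof.
move=> /posc_eq[d1 d10 ->] /posc_eq[d2 d20 ->].
exists (Num.min d1 d2)%:C; first by rewrite ltcR lt_min d10.
by rewrite !lecR !ge_min !lexx orbT.
Qed.

Lemma posc_inv_nat (e : R[i]) : 0 < e -> exists N, forall n, (N <= n)%N ->
  n.+1%:R^-1 <= e.
Proof.
move=> /posc_eq[d d0 ->].
have dV : 0 <= d^-1 by rewrite invr_ge0 ltW.
exists (Num.Def.archi_bound d^-1) => n Nn.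
have -> : n.+1%:R^-1 = (n.+1%:R^-1 : R)%:C by rewrite fmorphV rmorph_nat.
rewrite lecR -[leRHS]invrK lef_pV2 ?posrE ?ltr0n ?invr_gt0//.
apply: le_trans (ltW (archi_boundP dV)) _; rewrite ler_nat.
exact: leq_trans (leqnSn _).
Qed.

Lemma normc_le_Re_Im (z : R[i]) :
  `|z| <= (`|complex.Re z| + `|complex.Im z|)%:C.
Proof.
rewrite normc_def lecR -(@ler_pXn2r _ 2) ?nnegrE ?sqrtr_ge0 ?addr_ge0//.
rewrite sqr_sqrtr ?addr_ge0 ?sqr_ge0// sqrrD !real_normK ?num_real//.
have := mulr_ge0 (normr_ge0 (complex.Re z)) (normr_ge0 (complex.Im z)); lra.
Qed.

Lemma normc_ge_Im (z : R[i]) : `|complex.Im z|%:C <= `|z|.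
Proof.
rewrite normc_def lecR -sqrtr_sqr ler_sqrt ?lerDr ?sqr_ge0//.
by rewrite addr_ge0 ?sqr_ge0.
Qed.

Lemma complex_seq_complete : seq_complete R[i].
Proof.
move=> w cw.
pose re n (_ : unit) := complex.Re (w n); pose im n (_ : unit) := complex.Im (w n).
have cauchy d : 0 < d -> exists N, forall n m, (N <= n)%N -> (N <= m)%N ->
    `|w n - w m| <= d%:C by move=> d0; apply: cw; rewrite ltcR.
have [|r ur] := @uniform_cauchy_lim R unit re.
  move=> d /cauchy[N HN]; exists N => n m Nn Nm x.
  rewrite -lecR; apply: le_trans (HN n m Nn Nm); apply: le_trans (normc_ge_Re _).
  by rewrite /re raddfB.
have [|s us] := @uniform_cauchy_lim R unit im.
  move=> d /cauchy[N HN]; exists N => n m Nn Nm x.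
  rewrite -lecR; apply: le_trans (HN n m Nn Nm); apply: le_trans (normc_ge_Im _).
  by rewrite /im raddfB.
exists (Complex (r tt) (s tt)) => e /posc_eq[d d0 ->].
have [N HN] := ur (d / 2) ltac:(lra); have [M HM] := us (d / 2) ltac:(lra).
exists (maxn N M) => n; rewrite geq_max => /andP[Nn Mn].
apply: le_trans (normc_le_Re_Im _) _; rewrite lecR.
rewrite !raddfB/=; have := HN n Nn tt; have := HM n Mn tt; rewrite /re /im; lra.
Qed.

Lemma Cvec_seq_complete N : seq_complete (Cvec R N).
Proof.
move=> w cw.
have cwi i : exists v : R[i], forall e : R[i], 0 < e -> exists M, forall n,
    (M <= n)%N -> `|w n i 0 - v| <= e.
  apply: (@complex_seq_complete (fun n => w n i 0)) => e /cw[M HM].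
  exists M => n m Mn Mm; apply: le_trans (HM n m Mn Mm).
  by have := Cvec_coord_le (w n - w m) i; rewrite !mxE.
have [v Hv] := choice cwi.
exists (\col_i v i : Cvec R N) => e e0.
have d0 : 0 < e / N.+1%:R by rewrite divr_gt0.
have [M HM] := choice (fun i => Hv i _ d0).
exists (\max_i M i)%N => n Mn; apply: le_trans (Cvec_norm_le _) _.
apply: (@le_trans _ _ (\sum_(i < N) e / N.+1%:R)).
  apply: ler_sum => i _; rewrite !mxE; apply: HM.
  exact: leq_trans (leq_bigmax i) Mn.
rewrite sumr_const card_ord -[leLHS]mulr_natr -mulrA ler_piMr ?(ltW e0)//.
by rewrite mulrC ler_pdivrMr// mul1r ler_nat.
Qed.

Lemma bcont_seq_complete (X : topologicalType) (V : normedModType R[i]) :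
  seq_complete V -> seq_complete (bcont X V).
Proof.
move=> cV w cw.
have le_pt (f : bcont X V) x : `|f x| <= `|f| by exact: le_sup_norm.
have cwx x : exists v : V, forall e : R[i], 0 < e -> exists M, forall n,
    (M <= n)%N -> `|w n x - v| <= e.
  apply: (cV (fun n => w n x)) => e /cw[M HM].
  by exists M => n m Mn Mm; apply: le_trans (HM n m Mn Mm); exact: (le_pt (w n - w m)).
have [v Hv] := choice cwx.
have unif e : 0 < e -> exists N, forall n, (N <= n)%N -> forall x, `|w n x - v x| <= e.
  move=> e0; have [N HN] := cw e e0; exists N => n Nn x.
  apply/ler_addgt0Pr => d d0; have [M HM] := Hv x d d0.
  rewrite -(subrK (w (maxn N M) x) (w n x)) -addrA.
  apply: le_trans (ler_normD _ _) _; apply: lerD; last exact/HM/leq_maxr.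
  by apply: le_trans (HN n (maxn N M) Nn (leq_maxl _ _)); exact: (le_pt (w n - w _)).
have cv : continuous v.
  move=> x; apply/cvgrPdist_le => e e0.
  have d0 : 0 < e / 3 by rewrite divr_gt0.
  have [N HN] := unif _ d0; have := HN N (leqnn N) => wv.
  have /cvgrPdist_le/(_ _ d0) := @bcont_continuous _ _ _ (w N) x.
  apply: filterS => y wxy.
  have -> : v x - v y = (v x - w N x) + (w N x - w N y) + (w N y - v y).
    by rewrite !addrA !subrK.
  have -> : e = e / 3 + e / 3 + e / 3 by field.
  apply: le_trans (ler_normD _ _) _; apply: lerD => //.
  apply: le_trans (ler_normD _ _) _; apply: lerD => //.
  by rewrite distrC.
have bv : bounded_fun v.
  have [N HN] := unif 1 ltr01.
  apply/bounded_fun_ex; exists (`|w N| + 1); first by rewrite addr_ge0.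
  move=> x; rewrite -(subKr (w N x) (v x)).
  apply: le_trans (ler_normB _ _) _; apply: lerD; first exact: le_pt.
  exact: HN.
exists (mk_bcont cv bv) => e e0; have [N HN] := unif e e0; exists N => n Nn.
by apply: sup_norm_le => [|x]; [exact: ltW|exact: HN].
Qed.

End completeness.

(** * Mean ergodic semigroups *)

Section bop_lemmas.
Context (R : realType) (E F : normedModType R[i]).
Implicit Types (T : bop E F).

Lemma bopB T u v : T (u - v) = T u - T v.
Proof.
by have := bop_linear T (-1) v u; rewrite !scaleN1r ![- _ + _]addrC.
Qed.

Lemma bopD T u v : T (u + v) = T u + T v.
Proof. by have := bop_linear T 1 u v; rewrite !scale1r. Qed.

Lemma bopZ T a u : T (a *: u) = a *: T u.
Proof.
have T0 : T 0 = 0 by rewrite -(subrr (0 : E)) bopB subrr.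
by have := bop_linear T a u 0; rewrite T0 !addr0.
Qed.

Lemma convex_hull_ind (A P : set (bop E F)) : A `<=` P ->
  (forall S T (l : {i01 R[i]}), P S -> P T ->
    P (l%:num *: S + (1 - l%:num) *: T)) ->
  convex_hull A `<=` P.
Proof.
move=> AP Pconv; apply: smallest_sub => // S T l; rewrite !inE => PS PT.
exact: Pconv.
Qed.

Lemma convex_hull_conv (A : set (bop E F)) S T (l : {i01 R[i]}) :
  convex_hull A S -> convex_hull A T ->
  convex_hull A (l%:num *: S + (1 - l%:num) *: T).
Proof.
move=> AS AT B [cB AB]; have := cB S T l; rewrite !inE; apply.
  exact: (AS B (conj cB AB)).
exact: (AT B (conj cB AB)).
Qed.

Lemma convex_hull_sub (A : set (bop E F)) : A `<=` convex_hull A.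
Proof. exact: sub_gen_smallest. Qed.

Lemma i01_conv_norm_le (l : {i01 R[i]}) (u v : F) c : `|u| <= c -> `|v| <= c ->
  `|l%:num *: u + (1 - l%:num) *: v| <= c.
Proof.
move=> uc vc; apply: le_trans (ler_normD _ _) _; rewrite !normrZ.
have l0 : 0 <= l%:num :> R[i] by [].
have l1 : 0 <= 1 - l%:num :> R[i] by rewrite subr_ge0.
rewrite (ger0_norm l0) (ger0_norm l1).
have -> : c = l%:num * c + (1 - l%:num) * c by rewrite -mulrDl subrKC mul1r.
by apply: lerD; rewrite ler_wpM2l.
Qed.

(** The operators which are close to [P] at finitely many vectors form a base of
    neighbourhoods of [P] for the strong operator topology; this and
    [bop_approx_closure] express closures in these terms. *)
Lemma closure_bop_approx (A : set (bop E F)) (P : bop E F) : closure A P ->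
  forall (L : seq E) (e : R[i]), 0 < e ->
  exists2 C, A C & forall u, u \in L -> `|C u - P u| <= e.
Proof.
move=> clP L e e0.
have : nbhs P [set T | forall u, u \in L -> `|T u - P u| <= e].
  elim: L => [|u L IH]; first by apply: filterS filterT => T _ u.
  have /bop_cvgP/(_ u)/cvgrPdist_le/(_ e e0) : nbhs P --> P by [].
  apply: filterS2 IH => T TL Tu v; rewrite inE => /orP[/eqP->|]; last exact: TL.
  by rewrite distrC.
by move=> /clP[C [AC HC]]; exists C.
Qed.

Lemma bop_approx_closure (A : set (bop E F)) (P : bop E F) :
  (forall (L : seq E) (e : R[i]), 0 < e ->
    exists2 C, A C & forall u, u \in L -> `|C u - P u| <= e) ->
  closure A P.
Proof.
move=> HP.
pose B (p : seq E * R[i]) := [set C | A C /\ forall u, u \in p.1 -> `|C u - P u| <= p.2].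
pose FF : set_system (bop E F) := filter_from [set p | 0 < p.2] B.
have FFF : Filter FF.
  apply: filter_from_filter; first by exists ([::], 1) => /=.
  move=> [L1 e1] [L2 e2] /= e10 e20; have [e e0 [ee1 ee2]] := posc_min e10 e20.
  exists (L1 ++ L2, e) => // C [AC HC] /=; split; split=> // u uL.
    by apply: le_trans ee1; apply: HC; rewrite mem_cat uL.
  by apply: le_trans ee2; apply: HC; rewrite mem_cat uL orbT.
have FP : FF --> P.
  apply/bop_cvgP => u; apply/cvgrPdist_le => e e0.
  exists ([:: u], e) => // C [_ HC] /=; rewrite distrC; apply: HC.
  exact: mem_head.
move=> D /FP[[L e] e0 LD]; have [C AC HC] := HP L e e0.
by exists C; split=> //; apply: LD.
Qed.

End bop_lemmas.

Lemma convex_hull_rel (R : realType) (E F : normedModType R[i])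
    (A : set (bop E E)) (B : set (bop F F)) (P : bop E E -> bop F F -> Prop) :
  (forall C D C' D' (l : {i01 R[i]}), P C D -> P C' D' ->
    P (l%:num *: C + (1 - l%:num) *: C') (l%:num *: D + (1 - l%:num) *: D')) ->
  (forall C, A C -> exists2 D, B D & P C D) ->
  forall C, convex_hull A C -> exists2 D, convex_hull B D & P C D.
Proof.
move=> Pconv AB; apply: convex_hull_ind => [C /AB[D BD CD]|].
  by exists D => //; exact: convex_hull_sub.
move=> C C' l [D BD CD] [D' BD' CD'].
exists (l%:num *: D + (1 - l%:num) *: D'); first exact: convex_hull_conv.
exact: Pconv.
Qed.

Section intertwining.
Context (R : realType) (E F : normedModType R[i]) (I : Type) (J : I -> E -> F).
Hypothesis lJ : forall i, linear (J i).

Definition intertwines (C : bop E E) (D : bop F F) :=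
  forall i u, J i (C u) = D (J i u).

Lemma intertwinesB i u v : J i (u - v) = J i u - J i v.
Proof. by have := lJ i (-1) v u; rewrite !scaleN1r ![- _ + _]addrC. Qed.

Lemma intertwines_conv C D C' D' (l : {i01 R[i]}) :
  intertwines C D -> intertwines C' D' ->
  intertwines (l%:num *: C + (1 - l%:num) *: C') (l%:num *: D + (1 - l%:num) *: D').
Proof.
move=> CD CD' i u; have J0 : J i 0 = 0 by rewrite -(subrr (0 : E)) intertwinesB subrr.
have JZ a v : J i (a *: v) = a *: J i v by have := lJ i a v 0; rewrite J0 !addr0.
have := lJ i l%:num (C u) ((1 - l%:num) *: C' u).
by rewrite JZ CD CD'.
Qed.

End intertwining.

Section means.
Context (R : realType) (E : normedModType R[i]) (S : bop_semigroup E).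
Hypothesis S_contr : forall T, bop_semigroup_set S T -> forall u, `|T u| <= `|u|.

Local Notation co := (convex_hull S).

Lemma convex_hull_comp C D : co C -> co D -> co (bop_comp C D).
Proof.
move=> coC; move: D.
apply: (convex_hull_ind (P := [set D | co (bop_comp C D)])) => [D SD|D D' l coD coD'].
  move: C coC; apply: (convex_hull_ind (P := [set C | co (bop_comp C D)]))
    => [T ST|T T' l coT coT'].
    by apply: convex_hull_sub; exact: bop_semigroup_comp.
  rewrite /mkset (_ : bop_comp _ _ =
    l%:num *: bop_comp T D + (1 - l%:num) *: bop_comp T' D).
    exact: convex_hull_conv.
  by apply: bopP.
rewrite /mkset (_ : bop_comp _ _ =
    l%:num *: bop_comp C D + (1 - l%:num) *: bop_comp C D').
  exact: convex_hull_conv.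
by apply: bopP => u; rewrite /= bopD !bopZ.
Qed.

Lemma convex_hull_contr C u : co C -> `|C u| <= `|u|.
Proof.
move=> coC; apply: (convex_hull_ind (P := [set C | `|C u| <= `|u|])) coC.
  by move=> T ST; exact: S_contr.
by move=> T T' l Tu T'u; exact: i01_conv_norm_le.
Qed.

Lemma convex_hull_fix v C :
  (forall T, bop_semigroup_set S T -> T v = v) -> co C -> C v = v.
Proof.
move=> Sv; move: C.
apply: (convex_hull_ind (P := [set C | C v = v])) => // T T' l Tv T'v /=.
transitivity (l%:num *: T v + (1 - l%:num) *: T' v); first by [].
by rewrite Tv T'v -scalerDl subrKC scale1r.
Qed.

(** [v] is the mean of [u]. That every [C u] with [C] in the convex hull has
    the same mean [v] is part of the definition: means are then unique and
    additive although the semigroup is not commutative. *)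
Definition has_mean u v := (forall T, bop_semigroup_set S T -> T v = v) /\
  forall C (e : R[i]), co C -> 0 < e -> exists2 D, co D & `|D (C u) - v| <= e.

Lemma has_meanD u u' v v' : has_mean u v -> has_mean u' v' ->
  has_mean (u + u') (v + v').
Proof.
move=> [Sv mv] [Sv' mv']; split; first by move=> T ST; rewrite bopD Sv ?Sv'.
move=> C e coC e0; have d0 : 0 < e / 2 by rewrite divr_gt0.
have [D coD HD] := mv C _ coC d0.
have [D' coD' HD'] := mv' _ _ (convex_hull_comp coD coC) d0.
exists (bop_comp D' D) => /=; first exact: convex_hull_comp.
rewrite !bopD opprD addrACA [X in _ <= X]splitr.
apply: le_trans (ler_normD _ _) _; apply: lerD => //.
rewrite -[X in _ - X](convex_hull_fix Sv coD') -bopB.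
exact: le_trans (convex_hull_contr _ coD') _.
Qed.

Lemma has_meanZ a u v : has_mean u v -> has_mean (a *: u) (a *: v).
Proof.
move=> [Sv mv]; split; first by move=> T ST; rewrite bopZ Sv.
move=> C e coC e0.
have d0 : 0 < e / (`|a| + 1) by rewrite divr_gt0// ltr_wpDl.
have [D coD HD] := mv C _ coC d0; exists D => //.
rewrite !bopZ -scalerBr normrZ.
apply: le_trans (ler_wpM2l (normr_ge0 a) HD) _.
rewrite mulrA ler_pdivrMr; last by rewrite ltr_wpDl.
by rewrite mulrDr mulr1 [`|a| * e]mulrC lerDl ltW.
Qed.

Lemma has_meanB u u' v v' : has_mean u v -> has_mean u' v' ->
  has_mean (u - u') (v - v').
Proof. by move=> mu /(has_meanZ (-1)); rewrite !scaleN1r; exact: has_meanD. Qed.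

Lemma has_mean_convex_hull u v C : co C -> has_mean u v -> has_mean (C u) v.
Proof.
move=> coC [Sv mv]; split=> // D e coD e0.
exact: (mv _ _ (convex_hull_comp coD coC) e0).
Qed.

Hypothesis co0 : exists C, co C.

Lemma has_mean_le u v : has_mean u v -> `|v| <= `|u|.
Proof.
move=> [_ mv]; have [C coC] := co0; apply/ler_addgt0Pr => e e0.
have [D coD HD] := mv C e coC e0.
rewrite -(subKr (D (C u)) v); apply: le_trans (ler_normB _ _) _.
apply: lerD => //; apply: le_trans (convex_hull_contr _ coD) _.
exact: convex_hull_contr.
Qed.

Lemma has_mean_unique u v v' : has_mean u v -> has_mean u v' -> v = v'.
Proof.
move=> mv mv'; apply/eqP; rewrite -subr_eq0 -normr_le0.
by have := has_mean_le (has_meanB mv mv'); rewrite subrr normr0.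
Qed.

Lemma has_mean_closed u : seq_complete E ->
  (forall e : R[i], 0 < e -> exists u' v', has_mean u' v' /\ `|u - u'| <= e) ->
  exists v, has_mean u v.
Proof.
move=> cE Hu.
have /choice[w Hw] n : exists p : E * E, has_mean p.1 p.2 /\ `|u - p.1| <= n.+1%:R^-1.
  have [|u' [v' [mu' uu']]] := Hu (n.+1%:R^-1); first by rewrite invr_gt0.
  by exists (u', v').
have w_small e : 0 < e -> exists N, forall n, (N <= n)%N -> `|u - (w n).1| <= e.
  move=> /posc_inv_nat[N HN]; exists N => n Nn; apply: le_trans (HN n Nn).
  by have [] := Hw n.
have [|v Hv] := cE (fun n => (w n).2).
  move=> e e0; have [N HN] := w_small (e / 2) ltac:(by rewrite divr_gt0).
  exists N => n m Nn Nm; apply: le_trans (has_mean_le _) _.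
    exact: (has_meanB (Hw n).1 (Hw m).1).
  have -> : (w n).1 - (w m).1 = (u - (w m).1) - (u - (w n).1).
    by rewrite opprB [RHS]addrC addrA subrK.
  by apply: le_trans (ler_normB _ _) _; rewrite (splitr e); apply: lerD; exact: HN.
exists v; split.
  move=> T ST; apply/eqP; rewrite -subr_eq0 -normr_le0.
  apply/ler_addgt0Pr => e e0; rewrite add0r.
  have [N HN] := Hv (e / 2) ltac:(by rewrite divr_gt0).
  have [[Sw _] _] := Hw N.
  have -> : T v - v = ((w N).2 - v) - T ((w N).2 - v).
    by rewrite bopB Sw// opprB [RHS]addrC addrA subrK.
  apply: le_trans (ler_normB _ _) _; rewrite (splitr e); apply: lerD; first exact: HN.
  by apply: le_trans (S_contr ST _) _; exact: HN.
move=> C e coC e0; have d0 : 0 < e / 3 by rewrite divr_gt0.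
have [N HN] := Hv _ d0; have [M HM] := w_small _ d0.
pose n := maxn N M; have [[_ mw] _] := Hw n.
have [D coD HD] := mw C _ coC d0; exists D => //.
have -> : D (C u) - v =
    D (C (u - (w n).1)) + (D (C (w n).1) - (w n).2) + ((w n).2 - v).
  by rewrite !bopB !addrA !subrK.
have -> : e = e / 3 + e / 3 + e / 3 by field.
apply: le_trans (ler_normD _ _) _; apply: lerD; last exact/HN/leq_maxl.
apply: le_trans (ler_normD _ _) _; apply: lerD => //.
apply: le_trans (convex_hull_contr _ coD) _.
by apply: le_trans (convex_hull_contr _ coC) _; exact/HM/leq_maxr.
Qed.

Lemma mean_ergodic_has_mean P u :
  closure co P ->
  (forall T, closure co T -> bop_comp P T = P /\ bop_comp T P = P) ->
  has_mean u (P u).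
Proof.
move=> clP HP; split.
  move=> T ST; have [|_ /(congr1 (fun Q : bop E E => Q u))//] := HP T.
  by apply: subset_closure; exact: convex_hull_sub.
move=> C e coC e0.
have [|PC _] := HP C; first exact: subset_closure.
have [D coD HD] := closure_bop_approx clP [:: C u] e0.
exists D => //; have := HD (C u) (mem_head _ _).
by rewrite -[P (C u)]/(bop_comp P C u) PC.
Qed.

(** A common approximation of the means of finitely many vectors exists because an
    operator that brings one more vector close to its mean is a contraction
    which fixes the means of the others; this is the approximation that the
    strong operator topology asks for. *)
Lemma has_mean_mean_ergodic : (forall u, exists v, has_mean u v) -> mean_ergodic S.
Proof.
move=> /choice[p mp].
have p_lin : linear p.
  move=> a u v; apply: has_mean_unique (mp _) _.
  by apply: has_meanD => //; exact: has_meanZ.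
have p_cont : continuous p.
  apply: (@linear_bounded_continuous_fun _ _ _ _ 1) => // u.
  by rewrite mul1r; exact: has_mean_le.
pose P := mk_bop p_lin p_cont.
have approx (L : seq E) (e : R[i]) : 0 < e ->
    exists2 C, co C & forall u, u \in L -> `|C u - P u| <= e.
  move=> e0; elim: L => [|u L [C coC HC]]; first by have [C coC] := co0; exists C.
  have [_ mu] := mp u; have [D coD HD] := mu C e coC e0.
  exists (bop_comp D C) => /=; first exact: convex_hull_comp.
  move=> v; rewrite inE => /orP[/eqP->//|/HC vL].
  have [Sv _] := mp v; rewrite -[X in _ - X](convex_hull_fix Sv coD) -bopB.
  exact: le_trans (convex_hull_contr _ coD) _.
exists P; first exact: bop_approx_closure.
move=> T clT; split; apply: bopP => u /=; apply/eqP;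
  rewrite -subr_eq0 -normr_le0; apply/ler_addgt0Pr => e e0; rewrite add0r.
- have [C coC /(_ u (mem_head _ _)) HC] := closure_bop_approx clT [:: u] e0.
  have <- : p (C u) = p u.
    by apply: has_mean_unique (mp _) _; exact: has_mean_convex_hull.
  by rewrite distrC; apply: le_trans HC; apply: has_mean_le; exact: has_meanB.
- have [C coC /(_ _ (mem_head _ _)) HC] := closure_bop_approx clT [:: p u] e0.
  have [Su _] := mp u; move: HC; rewrite (convex_hull_fix Su coC).
  by rewrite distrC.
Qed.

End means.

Section transfer.
Context (R : realType) (E F : normedModType R[i])
  (S : bop_semigroup E) (T : bop_semigroup F) (I : finType) (J : I -> E -> F).
Hypotheses (S_contr : forall A, bop_semigroup_set S A -> forall u, `|A u| <= `|u|)
  (coS0 : exists C, convex_hull S C)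
  (lJ : forall i, linear (J i))
  (ST : forall A, bop_semigroup_set S A ->
    exists2 B, bop_semigroup_set T B & intertwines J A B)
  (TS : forall B, bop_semigroup_set T B ->
    exists2 A, bop_semigroup_set S A & intertwines J A B).

Let coST := convex_hull_rel (@intertwines_conv _ _ _ _ _ lJ) ST.

Let coTS C : convex_hull T C -> exists2 D, convex_hull S D & intertwines J D C.
Proof.
apply: (convex_hull_rel (P := fun C D => intertwines J D C)) => //.
by move=> *; exact: intertwines_conv.
Qed.

Lemma mean_ergodic_push i : (forall u, `|J i u| <= `|u|) ->
  mean_ergodic S -> forall u, exists v, has_mean T (J i u) v.
Proof.
move=> cJ [P clP HP] u; exists (J i (P u)).
have [SP mP] := mean_ergodic_has_mean u clP HP.
split; first by move=> B /TS[A SA JA]; rewrite -JA SP.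
move=> C e /coTS[D coD JD] e0.
have [D' /[dup] coD' /coST[C' coC' JC'] HD'] := mP D e coD e0.
exists C' => //; rewrite -JD -JC' -intertwinesB//.
exact: le_trans (cJ _) _.
Qed.

(** The mean of [u] is the limit of the [D_n u], for operators [D_n]
    corresponding to operators which approximate [P] at all the [J i u]
    simultaneously. *)
Lemma mean_ergodic_pull c : seq_complete E -> 0 < c ->
  (forall u e, (forall i, `|J i u| <= e) -> `|u| <= c * e) ->
  (forall i, continuous (J i)) ->
  mean_ergodic T -> mean_ergodic S.
Proof.
move=> cE c0 bJ cJ [P clP HP]; apply: has_mean_mean_ergodic => // u.
have mP x := mean_ergodic_has_mean x clP HP.
have approx n : exists D, convex_hull S D /\
    forall i, `|J i (D u) - P (J i u)| <= n.+1%:R^-1.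
  have e0 : 0 < n.+1%:R^-1 :> R[i] by rewrite invr_gt0.
  have [C /coTS[D coD JD] HC] := closure_bop_approx clP [seq J i u | i : I] e0.
  by exists D; split=> // i; rewrite JD; apply: HC; exact: map_f (mem_enum _ _).
have [D HD] := choice approx.
have JD e : 0 < e -> exists N, forall n, (N <= n)%N ->
    forall i, `|J i (D n u) - P (J i u)| <= e.
  move=> /posc_inv_nat[N HN]; exists N => n Nn i; apply: le_trans (HN n Nn).
  by have [] := HD n.
have [|v Hv] := cE (fun n => D n u).
  move=> e e0; have d0 : 0 < e / c / 2 by rewrite !divr_gt0.
  have [N HN] := JD _ d0; exists N => n m Nn Nm.
  have -> : e = c * (e / c) by rewrite mulrC divfK// gt_eqF.
  apply: bJ => i; rewrite intertwinesB//.
  have -> : J i (D n u) - J i (D m u) =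
      (J i (D n u) - P (J i u)) - (J i (D m u) - P (J i u)).
    by rewrite opprB addrA subrK.
  apply: le_trans (ler_normB _ _) _; rewrite [e / c]splitr.
  by apply: lerD; exact: HN.
have Jv i : J i v = P (J i u).
  apply/eqP; rewrite -subr_eq0 -normr_le0; apply/ler_addgt0Pr => e e0; rewrite add0r.
  have d0 : 0 < e / 2 by rewrite divr_gt0.
  have [N HN] := JD _ d0.
  have /cvgrPdist_le/(_ _ d0) := cJ i v; rewrite nearE => /nbhs_ballP[d /= dpos Hd].
  have [M HM] := Hv (d / 2) ltac:(by rewrite divr_gt0).
  pose n := maxn N M.
  have := Hd (D n u) _; rewrite -ball_normE /= => Hn.
  have {}Hn : `|J i v - J i (D n u)| <= e / 2.
    apply: Hn; rewrite distrC; apply: le_lt_trans (HM n (leq_maxr _ _)) _.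
    by rewrite ltr_pdivrMr// ltr_pMr// ltr1n.
  rewrite -(subrK (J i (D n u)) (J i v)) -addrA.
  apply: le_trans (ler_normD _ _) _; rewrite [e]splitr; apply: lerD => //.
  exact/HN/leq_maxl.
have J_inj x y : (forall i, J i x = J i y) -> x = y.
  move=> xy; apply/eqP; rewrite -subr_eq0 -normr_le0 -(mulr0 c); apply: bJ => i.
  by rewrite intertwinesB// xy subrr normr0.
exists v; split.
  move=> A /ST[B TB JA]; apply: J_inj => i; rewrite JA Jv.
  by have [Bfix _] := mP (J i u); exact: Bfix.
move=> C e /coST[B coB JB] e0; have d0 : 0 < e / c by rewrite divr_gt0.
have [B' /coTS[C' coC' JC'] HB'] := closure_bop_approx clP [seq J i (C u) | i : I] d0.
exists C' => //; have -> : e = c * (e / c) by rewrite mulrC divfK// gt_eqF.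
apply: bJ => i; rewrite intertwinesB// JC' Jv.
have <- : P (J i (C u)) = P (J i u).
  have [|PB _] := HP B; first exact: subset_closure.
  by rewrite JB -[P (B _)]/(bop_comp P B _) PB.
by apply: HB'; exact: map_f (mem_enum _ _).
Qed.

End transfer.

(** * Unitary representations *)

Section representations.
Context (R : realType) (Omega : topGroupType).

Lemma continuous_real_complex : continuous (fun x : R => x%:C : R[i]).
Proof.
move=> x; apply/cvgrPdist_le => e /posc_eq[d d0 ->].
have /cvgrPdist_le/(_ _ d0) : (fun y : R => y) @ x --> x by exact: cvg_id.
apply: filterS => y xy; rewrite -raddfB /= normc_def/= expr0n addr0 sqrtr_sqr.
by rewrite lecR.
Qed.

Lemma continuousC_mul (T : topologicalType) (f g : T -> R[i]) :
  continuous f -> continuous g -> continuous (fun x => f x * g x).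
Proof. by move=> cf cg x; apply: cvgM; [exact: cf|exact: cg]. Qed.

Lemma continuousC_sum (T : topologicalType) (I : Type) (r : seq I)
    (f : I -> T -> R[i]) :
  (forall i, continuous (f i)) -> continuous (fun x => \sum_(i <- r) f i x).
Proof.
by move=> cf x; apply: (cvg_big (op := +%R)) => [|i _];
  [exact: add_continuous|exact: cf].
Qed.

Lemma continuous_mx (T : topologicalType) m n (f : T -> 'M[R[i]]_(m, n)) :
  (forall i j, continuous (fun x => f x i j)) -> continuous f.
Proof.
move=> cf x A [P Px PA].
have : \forall y \near x, forall i j, P i j (f y i j).
  apply: filter_forall => i; apply: filter_forall => j.
  exact: (cf i j x _ (Px i j)).
by apply: filterS => y; exact: PA.
Qed.

Lemma continuous_coord (T : topologicalType) m n (f : T -> 'M[R[i]]_(m, n)) i j :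
  continuous f -> continuous (fun x => f x i j).
Proof.
move=> cf; exact: (continuous_compose (@coord_continuous _ m n i j) cf).
Qed.

Lemma adjmx_mul m n p (A : 'M[R[i]]_(m, n)) (B : 'M[R[i]]_(n, p)) :
  (A *m B)^t* = B^t* *m A^t*.
Proof. by rewrite trmx_mul map_mxM. Qed.

Section orthogonal.
Variables (n : nat) (rho : Omega -> 'M[R]_n).
Hypothesis rrho : orthogonal_rep rho.

Let pi w : 'M[R[i]]_n := map_mx (real_complex R) (rho w).

Let pi_continuous : continuous pi.
Proof.
apply: continuous_mx => i j; under eq_fun do rewrite mxE.
apply: (continuous_compose continuous_real_complex).
exact: (@orep_continuous _ _ _ _ rrho i j).
Qed.

Let pi_unitary w : pi w \is unitarymx.
Proof.
apply/unitarymxP; have -> : (pi w)^t* = map_mx (real_complex R) (rho w)^T.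
  by apply/matrixP => i j; rewrite !mxE; exact: conjc_real.
by rewrite -map_mxM (orep_orthogonal rrho) map_mx1.
Qed.

Let pi1 : pi 1%g = 1%:M.
Proof. by rewrite /pi (orep1 rrho) map_mx1. Qed.

Let piM w w' : pi (w * w')%g = pi w *m pi w'.
Proof. by rewrite /pi (orepM rrho) map_mxM. Qed.

Definition complexify_rep : unitary_rep R Omega n :=
  UnitaryRep pi_continuous pi_unitary pi1 piM.

End orthogonal.

Section reducible.
Variables (N : nat) (pi : unitary_rep R Omega N).

Lemma rep_adj w : (pi w)^t* = pi w^-1%g.
Proof.
have /unitarymxP u := rep_unitary pi w.
rewrite -[RHS]mul1mx -(mulmx1C u) -mulmxA -repM mulgV rep1.
by rewrite mulmx1.
Qed.

(** The columns of [B] are an orthonormal basis of the invariant subspace. *)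
Section subrepresentation.
Variables (r : nat) (B : 'M[R[i]]_(N, r)).
Hypotheses (B1 : B^t* *m B = 1%:M) (BA : forall w, exists A, pi w *m B = B *m A).

Let rho w := B^t* *m pi w *m B.

Let rhoE w : pi w *m B = B *m rho w.
Proof.
have [A HA] := BA w.
by rewrite /rho -mulmxA HA [B^t* *m _]mulmxA B1 mul1mx.
Qed.

Let rho_continuous : continuous rho.
Proof.
apply: continuous_mx => i j; rewrite /rho.
under eq_fun do rewrite mxE.
apply: continuousC_sum => k; apply: continuousC_mul; last by move=> x; exact: cvg_cst.
under eq_fun do rewrite mxE.
apply: continuousC_sum => l; apply: continuousC_mul; first by move=> x; exact: cvg_cst.
by apply: continuous_coord; exact: rep_continuous.
Qed.

Let rho_unitary w : rho w \is unitarymx.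
Proof.
apply/unitarymxP; apply: mulmx1C.
have -> : (rho w)^t* = B^t* *m (pi w)^t* *m B by rewrite /rho !adjmx_mul trmxCK mulmxA.
rewrite -[_ *m B *m _]mulmxA -rhoE mulmxA -[_ *m pi w]mulmxA.
by have /unitarymxP/mulmx1C -> := rep_unitary pi w; rewrite mulmx1.
Qed.

Let rho1 : rho 1%g = 1%:M.
Proof. by rewrite /rho rep1 mulmx1. Qed.

Let rhoM w w' : rho (w * w')%g = rho w *m rho w'.
Proof. by rewrite {1}/rho repM mulmxA -mulmxA rhoE mulmxA. Qed.

Definition subrep : unitary_rep R Omega r :=
  UnitaryRep rho_continuous rho_unitary rho1 rhoM.

Lemma subrepE w : pi w *m B = B *m subrep w.
Proof. exact: rhoE. Qed.

End subrepresentation.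

(** Orthonormal bases of an invariant subspace and of its orthogonal complement
    decompose a reducible representation. *)
Lemma reducible_decomposition : (0 < N)%N -> ~ irreducible_rep pi ->
  exists r1 r2 (B1 : 'M[R[i]]_(N, r1)) (B2 : 'M[R[i]]_(N, r2))
    (pi1 : unitary_rep R Omega r1) (pi2 : unitary_rep R Omega r2),
  [/\ (r1 < N)%N, (r2 < N)%N & forall w,
    pi w = B1 *m pi1 w *m B1^t* + B2 *m pi2 w *m B2^t*].
Proof.
move=> N0 /not_andP[//|/existsNP[W /not_implyP[Winv /not_orP[W0 Wfull]]]].
(* The row space of [V] is the conjugate transpose of [W]; with the conjugation,
   orthonormality of rows means orthonormality of the vectors of [W]. *)
pose V : 'M[R[i]]_(\dim W, N) := \matrix_(i, j) ((vbasis W)`_i j 0)^*%C.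
have rowV i : row i V = ((vbasis W)`_i)^t*.
  by apply/rowP => j; rewrite !mxE.
have memW (v : 'cV_N) : (v \in W) = (v^t* <= V)%MS.
  apply/idP/idP => [vW|/submxP[D HD]].
    rewrite {1}(coord_vbasis vW) linear_sum raddf_sum/=.
    apply: summx_sub => i _; rewrite linearZ/= map_mxZ.
    by apply: scalemx_sub; rewrite -rowV row_sub.
  have -> : v = \sum_(i < \dim W) (D 0 i)^*%C *: (vbasis W)`_i.
    rewrite -[LHS]trmxCK HD mulmx_sum_row linear_sum raddf_sum/=.
    by apply: eq_bigr => i _; rewrite linearZ/= map_mxZ/= rowV trmxCK.
  apply: memv_suml => i _; apply: memvZ; apply: vbasis_mem.
  by rewrite mem_nth// size_tuple.
have rV0 : (0 < \rank V)%N.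
  rewrite lt0n mxrank_eq0; apply/eqP => V0; apply: W0; apply/eqP.
  rewrite -subv0; apply/subvP => v; rewrite memW V0 => /submx0null v0.
  by rewrite -[v]trmxCK v0 trmx0 map_mx0 mem0v.
have rVN : (\rank V < N)%N.
  rewrite ltn_neqAle rank_leq_col andbT; apply/eqP => VN; apply: Wfull; apply/eqP.
  rewrite eqEsubv subvf/=; apply/subvP => v _; rewrite memW.
  by apply: submx_full; rewrite /row_full VN.
pose M := schmidt_complete V.
have rM := add_rank_ortho V.
have /unitarymxP MM := schmidt_complete_unitarymx V : M \is unitarymx.
have MM' : M^t* *m M = 1%:M.
  have /row_fullP[X XM] : row_full M.
    by rewrite /row_full mxrank_unitary ?schmidt_complete_unitarymx// rM.
  by rewrite -[LHS]mul1mx -{1}XM -mulmxA (mulmxA M) MM mul1mx.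
pose U1 := usubmx M; pose U2 := dsubmx M.
have U1E : U1 = schmidt (row_base V) by exact: col_mxKu.
have U1V : (U1 :=: V)%MS.
  by rewrite U1E; apply: eqmx_trans (eqmx_schmidt_free (row_base_free _)) (eq_row_base _).
move: MM MM'; rewrite -[M]vsubmxK -/U1 -/U2 tr_col_mx map_row_mx.
rewrite mul_col_row mul_row_col scalar_mx_block.
move=> /eq_block_mx[U11 U12 U21 U22] UU.
pose B1 := U1^t*; pose B2 := U2^t*.
have B1K : B1^t* = U1 by rewrite trmxCK.
have B2K : B2^t* = U2 by rewrite trmxCK.
have inv1 w : exists A, pi w *m B1 = B1 *m A.
  suff /submxP[X HX] : ((pi w *m B1)^t* <= U1)%MS.
    by exists (X^t*); rewrite -[LHS]trmxCK HX adjmx_mul.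
  apply/row_subP => j; rewrite U1V.
  have -> : row j ((pi w *m B1)^t*) = (pi w *m ((row j U1)^t*))^t*.
    by rewrite !adjmx_mul !trmxCK row_mul.
  rewrite -memW; apply: Winv; rewrite memW trmxCK.
  by apply: submx_trans (row_sub _ _) _; rewrite U1V.
have B1B1 : B1^t* *m B1 = 1%:M by rewrite B1K.
have B2B2 : B2^t* *m B2 = 1%:M by rewrite B2K.
have inv2 w : exists A, pi w *m B2 = B2 *m A.
  exists (B2^t* *m (pi w *m B2)).
  rewrite -[LHS]mul1mx -UU mulmxDl -/B1 -/B2 B2K -!mulmxA.
  rewrite -[RHS]add0r; congr (_ + _).
  have [A HA] := inv1 w^-1%g.
  have -> : U1 *m (pi w *m B2) = (B2^t* *m (pi w^-1%g *m B1))^t*.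
    by rewrite !adjmx_mul !trmxCK rep_adj invgK mulmxA.
  by rewrite HA mulmxA B2K U21 mul0mx trmx0 map_mx0 mulmx0.
exists (\rank V), _, B1, B2, (subrep B1B1 inv1), (subrep B2B2 inv2); split=> //.
  by rewrite -(ltn_add2l (\rank V)) rM -[X in (X < _)%N]add0n ltn_add2r.
move=> w; rewrite -!subrepE -!mulmxA -mulmxDr.
by rewrite B1K B2K UU mulmx1.
Qed.

End reducible.

End representations.

(** * Vector-valued functions as functions on the skew product *)

Section skew.
Context (R : realType) (G : semitopSemigroupType) (K : topologicalType)
  (Omega : topGroupType) (act : continuous_action G K)
  (gamma : continuous_cocycle act Omega).

Local Notation T := (koopman_semigroup (skew_product gamma) R[i]).

Section coef_op.
Variables (N : nat) (pi : unitary_rep R Omega N) (i : 'I_N).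
Implicit Types f : bcont K (Cvec R N).

Lemma coef_fun_continuous f :
  continuous (fun p : K * Omega => (pi p.2 *m (f p.1 : 'cV__)) i 0).
Proof.
under eq_fun do rewrite mxE.
have /Cvec_continuousP cf := @bcont_continuous _ _ _ f.
apply: continuousC_sum => j; apply: continuousC_mul.
  apply: continuous_coord; apply: continuous_compose; first exact: rep_continuous.
  by move=> q; exact: cvg_snd.
by apply: (continuous_compose (cf j)) => q; exact: cvg_fst.
Qed.

Lemma coef_fun_le f (p : K * Omega) :
  `|(pi p.2 *m (f p.1 : 'cV__)) i 0| <= `|f|.
Proof.
apply: le_trans (Cvec_coord_le (pi p.2 *m f p.1 : Cvec R N) i) _.
by rewrite unitarymx_norm ?rep_unitary//; exact: le_sup_norm.
Qed.

Lemma coef_fun_bounded f :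
  bounded_fun (fun p : K * Omega => (pi p.2 *m (f p.1 : 'cV__)) i 0).
Proof. by apply/bounded_fun_ex; exists `|f| => // p; exact: coef_fun_le. Qed.

Definition coef_op f : bcont (K * Omega)%type R[i] :=
  mk_bcont (@coef_fun_continuous f) (coef_fun_bounded f).

Lemma coef_op_linear : linear coef_op.
Proof.
move=> c u v; apply: bcontP => p.
transitivity ((pi p.2 *m (c *: (u p.1 : 'cV__) + v p.1)) i 0); first by [].
by rewrite mulmxDr -scalemxAr mxE [X in X + _]mxE.
Qed.

Lemma coef_op_le f : `|coef_op f| <= `|f|.
Proof. by apply: sup_norm_le => // p; exact: coef_fun_le. Qed.

Lemma coef_op_koopman g f :
  coef_op (twisted_koopman gamma pi g f) =
  koopman (skew_product gamma) R[i] g (coef_op f).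
Proof.
by apply: bcontP => -[x w] /=; rewrite repM mulmxA.
Qed.

End coef_op.

Lemma koopman_contr A : bop_semigroup_set T A -> forall u, `|A u| <= `|u|.
Proof. by move=> [g _ <-] u; exact: koopman_fun_le. Qed.

Lemma twisted_koopman_contr N (pi : unitary_rep R Omega N) A :
  bop_semigroup_set (twisted_koopman_semigroup gamma pi) A ->
  forall u, `|A u| <= `|u|.
Proof.
move=> [g _ <-] u.
by apply: le_trans (mulop_fun_le _ _ _) _; exact: koopman_fun_le.
Qed.

Section intertwiners.
Variables (N : nat) (pi : unitary_rep R Omega N).

Local Notation S := (twisted_koopman_semigroup gamma pi).

Lemma twisted_koopman_intertwines A : bop_semigroup_set S A ->
  exists2 B, bop_semigroup_set T B & intertwines (coef_op pi) A B.
Proof.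
move=> [g _ <-]; exists (koopman (skew_product gamma) R[i] g); first by exists g.
by move=> i u; exact: coef_op_koopman.
Qed.

Lemma koopman_intertwines B : bop_semigroup_set T B ->
  exists2 A, bop_semigroup_set S A & intertwines (coef_op pi) A B.
Proof.
move=> [g _ <-]; exists (twisted_koopman gamma pi g); first by exists g.
by move=> i u; exact: coef_op_koopman.
Qed.

Lemma coef_op_norm_le (f : bcont K (Cvec R N)) e : (0 < N)%N ->
  (forall i, `|coef_op pi i f| <= e) -> `|f| <= N%:R * e.
Proof.
move=> N0 fe; have e0 : 0 <= e by exact: le_trans (fe (Ordinal N0)).
apply: sup_norm_le => [|x]; first by rewrite mulr_ge0.
apply: le_trans (Cvec_norm_le _) _.
apply: (@le_trans _ _ (\sum_(i < N) e)); last first.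
  by rewrite sumr_const card_ord mulr_natl.
apply: ler_sum => i _; apply: le_trans (fe i).
have := le_sup_norm (coef_op pi i f) (x, 1%g).
by rewrite /= rep1 mul1mx.
Qed.

End intertwiners.

Lemma mean_ergodic_twisted N (pi : unitary_rep R Omega N) (g : G) : (0 < N)%N ->
  mean_ergodic T -> mean_ergodic (twisted_koopman_semigroup gamma pi).
Proof.
move=> N0; apply: (@mean_ergodic_pull _ _ _ _ _ _ (coef_op pi) _ _ _ _ _ N%:R).
- exact: twisted_koopman_contr.
- exists (twisted_koopman gamma pi g); apply: convex_hull_sub; by exists g.
- by move=> i; exact: coef_op_linear.
- exact: twisted_koopman_intertwines.
- exact: koopman_intertwines.
- exact/bcont_seq_complete/Cvec_seq_complete.
- by rewrite ltr0n.
- by move=> u e; exact: coef_op_norm_le.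
- move=> i; apply: (@linear_bounded_continuous_fun _ _ _ _ 1).
    exact: coef_op_linear.
  by move=> f; rewrite mul1r coef_op_le.
Qed.

Section converse.
Hypotheses (cK : compact [set: K]) (cO : compact [set: Omega])
  (hO : hausdorff_space Omega) (g0 : G).
Hypothesis irr_ergodic : forall (N : nat) (pi : unitary_rep R Omega N),
  irreducible_rep pi -> mean_ergodic (twisted_koopman_semigroup gamma pi).

Let M (u : bcont (K * Omega)%type R[i]) := exists v, has_mean T u v.

Let MD u v : M u -> M v -> M (u + v).
Proof.
by move=> [u' mu] [v' mv]; exists (u' + v'); apply: has_meanD => //; exact: koopman_contr.
Qed.

Let MZ a u : M u -> M (a *: u).
Proof. by move=> [u' mu]; exists (a *: u'); exact: has_meanZ. Qed.

Let M0 : M 0.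
Proof.
have C0 (C : bop (bcont (K * Omega)%type R[i]) (bcont (K * Omega)%type R[i])) :
  C 0 = 0 by rewrite -(subrr 0) bopB !subrr.
exists 0; split=> [A _|C e coC e0]; first exact: C0.
by exists C => //; rewrite !C0 subrr normr0 ltW.
Qed.

Let M_sum (I : Type) (r : seq I) (F : I -> bcont (K * Omega)%type R[i]) :
  (forall i, M (F i)) -> M (\sum_(i <- r) F i).
Proof.
move=> MF; elim: r => [|i r IH]; first by rewrite big_nil; exact: M0.
by rewrite big_cons; exact: MD (MF i) IH.
Qed.

Let M_closed u :
  (forall e, 0 < e -> exists u', M u' /\ `|u - u'| <= e) -> M u.
Proof.
move=> Hu; apply: has_mean_closed.
- exact: koopman_contr.
- exists (koopman (skew_product gamma) R[i] g0); apply: convex_hull_sub; by exists g0.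
- exact/bcont_seq_complete/complex_seq_complete.
- by move=> e /Hu[u' [[v mv] uu']]; exists u', v.
Qed.

Let bcont_sumE (I : Type) (r : seq I) (X : topologicalType) (V : normedModType R[i])
  (F : I -> bcont X V) x : (\sum_(i <- r) F i) x = \sum_(i <- r) F i x.
Proof.
elim: r => [|i r IH]; first by rewrite !big_nil.
by rewrite !big_cons -IH.
Qed.

Lemma mulmx_bcont_continuous m n (A : 'M[R[i]]_(m, n)) (f : bcont K (Cvec R n)) :
  continuous (fun x => A *m (f x : 'cV__) : Cvec R m).
Proof.
have /Cvec_continuousP cf := @bcont_continuous _ _ _ f.
apply/Cvec_continuousP => i; under eq_fun do rewrite mxE.
apply: continuousC_sum => j; apply: continuousC_mul => //.
by move=> x; exact: cvg_cst.
Qed.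

(** By induction on the dimension, as a coefficient of a reducible representation
    is a combination of coefficients of two smaller ones. *)
Lemma mean_coef_op N (pi : unitary_rep R Omega N) i f : M (coef_op pi i f).
Proof.
suff H n : forall N (pi : unitary_rep R Omega N) i f, (N < n)%N -> M (coef_op pi i f).
  exact: (H N.+1) (ltnSn N).
move: N pi i f => _ _ _ _; elim: n => [|n IH] N pi i f.
  by move=> N0; exfalso; rewrite ltn0 in N0.
rewrite ltnS => Nn.
have [irr|red] := pselect (irreducible_rep pi).
  apply: (mean_ergodic_push (S := twisted_koopman_semigroup gamma pi)
    (J := coef_op pi)) (irr_ergodic irr) f.
  - by move=> j; exact: coef_op_linear.
  - exact: twisted_koopman_intertwines.
  - exact: koopman_intertwines.
  - by move=> u; exact: coef_op_le.
have N0 : (0 < N)%N by exact: leq_ltn_trans (ltn_ord i).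
have [r1 [r2 [B1 [B2 [pi1 [pi2 [r1N r2N piE]]]]]]] := reducible_decomposition N0 red.
pose sub r (B : 'M[R[i]]_(N, r)) : bcont K (Cvec R r) :=
  mk_bcont (@mulmx_bcont_continuous _ _ (B^t*) f)
    (compact_bounded_fun cK (@mulmx_bcont_continuous _ _ (B^t*) f)).
rewrite (_ : coef_op pi i f =
    \sum_j B1 i j *: coef_op pi1 j (sub _ B1) +
    \sum_j B2 i j *: coef_op pi2 j (sub _ B2)).
  by apply: MD; apply: M_sum => j; apply: MZ; apply: IH; exact: leq_trans Nn.
apply: bcontP => p.
have subE r (B : 'M[R[i]]_(N, r)) (rho : unitary_rep R Omega r) :
    (\sum_j B i j *: coef_op rho j (sub _ B)) p =
    (B *m rho p.2 *m B^t* *m (f p.1 : 'cV__)) i 0.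
  by rewrite bcont_sumE -!mulmxA mxE; apply: eq_bigr.
transitivity ((pi p.2 *m (f p.1 : 'cV__)) i 0); first by [].
by rewrite piE mulmxDl mxE -!subE.
Qed.

(** The elements of [tensor_span] are bare functions; the element of the function
    space which represents one of them comes with its mean. *)
Let real_mean (F : K -> Omega -> R) := exists u : bcont (K * Omega)%type R[i],
  (forall x w, u (x, w) = (F x w)%:C) /\ M u.

Let tensor_mean F : tensor_span F -> real_mean F.
Proof.
elim=> [|n rho i j h {}F rrho ch _ [u [uF Mu]]]; first by exists 0.
have ch' : continuous (fun x => (h x)%:C *: (delta_mx j 0 : 'cV__) : Cvec R n).
  apply/Cvec_continuousP => k; under eq_fun do rewrite mxE.
  apply: continuousC_mul; last by move=> x; exact: cvg_cst.
  exact: (continuous_compose (@continuous_real_complex R)).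
pose f := mk_bcont ch' (compact_bounded_fun cK ch').
exists (coef_op (complexify_rep rrho) i f + u); split; last first.
  by apply: MD; [exact: mean_coef_op|exact: Mu].
move=> x w.
transitivity ((map_mx (real_complex R) (rho w) *m
    ((h x)%:C *: (delta_mx j 0 : 'cV__))) i 0 + u (x, w)); first by [].
by rewrite uF -scalemxAr mxE -colE !mxE -rmorphM -rmorphD.
Qed.

Let continuous_mean (F : K -> Omega -> R) (u : bcont (K * Omega)%type R[i]) :
  continuous (fun p : K * Omega => F p.1 p.2) ->
  (forall x w, u (x, w) = (F x w)%:C) -> M u.
Proof.
move=> cF uF; apply: M_closed => _ /posc_eq[e e0 ->].
have [H /tensor_mean[v [vH Mv]] FH] := tensor_span_dense cK cO hO cF e0.
exists v; split; first exact: Mv.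
apply: sup_norm_le => [|[x w]]; first by rewrite ler0c ltW.
rewrite -[(u - v) (x, w)]/(u (x, w) - v (x, w)) uF vH -rmorphB.
by rewrite normc_def/= expr0n addr0 sqrtr_sqr lecR.
Qed.

Lemma mean_ergodic_koopman_skew : mean_ergodic T.
Proof.
apply: has_mean_mean_ergodic => [|| u]; first exact: koopman_contr.
  exists (koopman (skew_product gamma) R[i] g0); apply: convex_hull_sub; by exists g0.
have cu := @bcont_continuous _ _ _ u.
have cont_lip (phi : R[i] -> R) : (forall z z', `|phi z - phi z'|%:C <= `|z - z'|) ->
    continuous (fun p => phi (u p)).
  move=> philip p; apply/cvgrPdist_le => e e0.
  have /cvgrPdist_le/(_ e%:C) := cu p; rewrite ltcR => /(_ e0).
  apply: filterS => q upq; rewrite -lecR; exact: le_trans (philip _ _) upq.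
have cRe : continuous (fun p => complex.Re (u p)).
  by apply: cont_lip => z z'; rewrite -raddfB; exact: normc_ge_Re.
have cIm : continuous (fun p => complex.Im (u p)).
  by apply: cont_lip => z z'; rewrite -raddfB; exact: normc_ge_Im.
have cKO := compact_setX cK cO; rewrite setXTT in cKO.
have cReC := continuous_compose (@continuous_real_complex R) cRe.
have cImC := continuous_compose (@continuous_real_complex R) cIm.
pose uRe := mk_bcont cReC (compact_bounded_fun cKO cReC).
pose uIm := mk_bcont cImC (compact_bounded_fun cKO cImC).
have -> : u = uRe + 'i%C *: uIm.
  by apply: bcontP => p; exact: complexE.
apply: MD; last apply: MZ.
  apply: (@continuous_mean (fun x w => complex.Re (u (x, w)))); last by [].
  by apply: (continuous_compose cRe); cont.
apply: (@continuous_mean (fun x w => complex.Im (u (x, w)))); last by [].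
by apply: (continuous_compose cIm); cont.
Qed.

End converse.

End skew.

(** On the empty semigroup the constant function 1 is the zero function, where a
    linear functional cannot take the value 1. *)
Lemma right_amenable_inhabited (R : realType) (G : semitopSemigroupType) :
  right_amenable R G -> inhabited G.
Proof.
move=> [m [m1 _ _]]; apply: contrapT => G0.
have eq0 : bcont_cst G (1 : R[i]) = 0 by apply: bcontP => g; case: G0.
move: m1; rewrite eq0 -(subrr (0 : bcont G R[i])) bopB subrr => /eqP.
by rewrite eq_sym oner_eq0.
Qed.

Theorem theorem3p1 (R : realType) (G : semitopSemigroupType)
    (K : topologicalType) (Omega : topGroupType)
    (act : continuous_action G K) (gamma : continuous_cocycle act Omega) :
  right_amenable R G ->
  compact [set: K] -> hausdorff_space K ->
  compact [set: Omega] -> hausdorff_space Omega ->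
  mean_ergodic (koopman_semigroup (skew_product gamma) R[i]) <->
  (forall (N : nat) (pi : unitary_rep R Omega N), irreducible_rep pi ->
    mean_ergodic (twisted_koopman_semigroup gamma pi)).
Proof.
move=> /right_amenable_inhabited[g] cK _ cO hO; split=> [Tergodic N pi [N0 _]|].
  exact: mean_ergodic_twisted.
exact: mean_ergodic_koopman_skew.
Qed.
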